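(* Let $M$ be a positive integer, $N\ge0$, and $\lambda,\mu\in\mathrm{SP}(N)$. Then $$C^{[M]}_{\lambda\mu}(t)=t^{(M-1)N}\,C^{[M]}_{\lambda\mu}(t^{-1}).$$ Consequently, $C^{[M]}_{\lambda\mu}(t)$ is palindromic of darga $(M-1)N$. Moreover, $$C^{[M]}_{\lambda\mu}(0)=\delta_{\lambda\mu},\qquad [t^{(M-1)N}]\,C^{[M]}_{\lambda\mu}(t)=\delta_{\lambda\mu},$$ where $[t^k]f$ denotes the coefficient of $t^k$ in $f$.
   Context: A polynomial $f(t)$ is called palindromic of darga $d$ if $f(t)=t^df(t^{-1})$ (zero coefficients at both ends of the interval $[0,d]$ are allowed). A strict partition is a finite sequence $\lambda=(\lambda_1>\cdots>\lambda_\ell>0)$ of integers, with $|\lambda|=\sum\lambda_i$, $\ell(\lambda)=\ell$; $\mathrm{SP}(N)$ is the set of strict partitions of $N$. Let $\Gamma=\mathbb{Q}[p_1,p_3,p_5,\ldots]$ be the ring of odd power sums, graded by $\deg p_n=n$, with degree-$N$ component $\Gamma_N$. The Schur $Q$-functions $Q_\lambda\in\Gamma$ are defined as follows: $q_r$ is given by $\sum_{r\ge0}q_rz^r=\exp\bigl(2\sum_{n\ge1,\ n\text{ odd}}\frac{p_n}{n}z^n\bigr)$; for $r\ge s\ge0$ let $Q_{(r,s)}=q_rq_s+2\sum_{k=1}^{s}(-1)^kq_{r+k}q_{s-k}$; in general $Q_\lambda$ is the Pfaffian of the antisymmetric matrix with entries $Q_{(\lambda_i,\lambda_j)}$ for $i<j$,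 where a zero part is appended to $\lambda$ if $\ell(\lambda)$ is odd (so $Q_{(r)}=q_r$, $Q_\varnothing=1$). $\{Q_\lambda:\lambda\in\mathrm{SP}(N)\}$ is a basis of $\Gamma_N$. For indeterminates $t,s$, let $T_{t,s}$ be the algebra automorphism of $\Gamma$ (scalars extended to $\mathbb{Q}(t,s)$) with $T_{t,s}(p_n)=\frac{1-t^n}{1-s^n}p_n$ for $n$ odd, and define $C_{\lambda\mu}(t,s)$, $\lambda,\mu\in\mathrm{SP}(N)$, by $T_{t,s}Q_\lambda=\sum_{\mu\in\mathrm{SP}(N)}C_{\lambda\mu}(t,s)Q_\mu$. For a positive integer $M$ set $C^{[M]}_{\lambda\mu}(t):=C_{\lambda\mu}(t^M,t)$. Equivalently, $C^{[M]}_{\lambda\mu}(t)$, which is a polynomial in $t$, is determined by $$Q_\lambda[X+tX+\cdots+t^{M-1}X]=\sum_{\mu\in\mathrm{SP}(|\lambda|)}C^{[M]}_{\lambda\mu}(t)Q_\mu(X),$$ where the left side is the image of $Q_\lambda$ under the algebra map $p_n\mapsto(1+t^n+\cdots+t^{(M-1)n})p_n$ ($n$ odd). *)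

(* Defs.v *)
From HB Require Import structures.
From mathcomp Require Import all_boot all_order all_fingroup all_algebra.
From mathcomp Require Import fraction finmap monalg.

Set Implicit Arguments.
Unset Strict Implicit.
Unset Printing Implicit Defensive.

Import GRing.Theory.
Local Open Scope ring_scope.

Notation "x %:F" := (@FracField.tofrac _ x) : ring_scope.

(* ------------------------------------------------------------------------ *)
(* Strict partitions, as strictly decreasing sequences of positive integers *)

Definition strict_partition (N : nat) (l : seq nat) : bool :=
  [&& sorted gtn l, all (leq 1) l & sumn l == N].

Record SP (N : nat) : predArgType :=
  StrictPartition { parts :> seq nat; _ : strict_partition N parts }.

HB.instance Definition _ N := [isSub for @parts N].
HB.instance Definition _ N := [Countable of SP N by <:].

(* Finiteness: a strict partition of N is determined by its set of parts. *)
Section SPFinite.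
Variable N : nat.

Definition SP_to_set (l : SP N) : {set 'I_N.+1} :=
  [set i : 'I_N.+1 | (i : nat) \in parts l].

Definition set_to_SP (A : {set 'I_N.+1}) : option (SP N) :=
  insub (sort geq [seq val i | i <- enum A]).

Lemma SP_to_setK : pcancel SP_to_set set_to_SP.
Proof.
move=> l; have /and3P[l_sorted l_pos /eqP l_sum] := valP l.
rewrite /set_to_SP; have gtn_trans : transitive gtn.
  by move=> y x z /= yx zy; apply: ltn_trans zy yx.
have l_uniq : uniq l.
  by apply: sorted_uniq l_sorted => // x; rewrite /= ltnn.
have le_sumn (s : seq nat) x : x \in s -> (x <= sumn s)%N.
  elim: s => //= y s IHs; rewrite inE => /orP[/eqP->|/IHs le_xs].
    exact: leq_addr.
  exact: leq_trans le_xs (leq_addl _ _).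
have -> : sort geq [seq val i | i <- enum (SP_to_set l)] = l :> seq nat.
  have geq_anti : antisymmetric geq.
    by move=> x y /= /andP[yx xy]; apply/eqP; rewrite eqn_leq yx xy.
  have geq_trans : transitive geq.
    by move=> y x z /= yx zy; apply: leq_trans zy yx.
  apply: (sorted_eq geq_trans geq_anti).
  - by apply: sort_sorted => x y /=; apply: leq_total.
  - by apply: sub_sorted l_sorted => x y /= /ltnW.
  rewrite perm_sort; apply: uniq_perm => //.
    by rewrite map_inj_uniq ?enum_uniq //; apply: val_inj.
  move=> x; apply/mapP/idP => [[i]|xl].
    by rewrite mem_enum inE => il ->.
  have x_lt : (x < N.+1)%N by rewrite ltnS -l_sum; apply: le_sumn.
  by exists (Ordinal x_lt); rewrite ?mem_enum ?inE.
by rewrite valK.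
Qed.

HB.instance Definition _ := isFinite.Build (SP N) (pcan_enumP SP_to_setK).
End SPFinite.

(* ------------------------------------------------------------------------ *)
(* The ring K[p_1, p_3, p_5, ...]; the variable of index i is p_(2i+1)      *)

Definition Gamma (K : comNzRingType) := {malg K[{cmonom nat}]}.

(* [psum K n] is p_n; only meaningful for n odd. *)
Definition psum (K : comNzRingType) (n : nat) : Gamma K := << ucm n./2 >>.

Definition Gamma_extend (K L : comNzRingType) (f : K -> L) (g : Gamma K) :
    Gamma L :=
  mmap (fun c : K => (f c)%:MP : Gamma L) (fun m => << m >> : Gamma L) g.

(* The K-algebra endomorphism sending p_n to v n, for all odd n. *)
Definition Gamma_subst (K : comNzRingType) (v : nat -> Gamma K) (g : Gamma K) :
    Gamma K :=
  mmap (fun c : K => c%:MP : Gamma K)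
       (fun m : {cmonom nat} =>
          \prod_(i <- finsupp (cmonom_val m)) v i.*2.+1 ^+ cmonom_val m i) g.

(* ------------------------------------------------------------------------ *)
(* Schur Q-functions                                                        *)

Notation GammaQ := (Gamma rat).

(* 2 * sum of (p_n / n) z^n over odd n <= r *)
Definition log_qseries (r : nat) : {poly GammaQ} :=
  \sum_(n < r.+1 | odd n) (2 *: ((n%:R : rat)^-1 *: psum rat n))%:P * 'X^n.

(* Coefficient of z^r in exp (2 * sum of (p_n / n) z^n): the exponent has no *)
(* constant term, so only its terms of degree <= r, and its powers of        *)
(* exponent <= r, contribute.                                                *)
Definition qfun (r : nat) : GammaQ :=
  \sum_(k < r.+1) (k`!%:R : rat)^-1 *: (log_qseries r ^+ k)`_r.

Definition Qpair (r s : nat) : GammaQ :=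
  qfun r * qfun s +
  2%:R * \sum_(1 <= k < s.+1) (-1) ^+ k * (qfun (r + k) * qfun (s - k)).

Section Pfaffian.
Variables (R : comAlgType rat) (m : nat).

Fact pair_fst_subproof (i : 'I_m) : (i.*2 < m.*2)%N.
Proof. by rewrite ltn_double. Qed.

Fact pair_snd_subproof (i : 'I_m) : (i.*2.+1 < m.*2)%N.
Proof. by rewrite ltn_Sdouble. Qed.

Definition pair_fst (i : 'I_m) : 'I_(m.*2) := Ordinal (pair_fst_subproof i).
Definition pair_snd (i : 'I_m) : 'I_(m.*2) := Ordinal (pair_snd_subproof i).

Definition pfaffian (A : 'M[R]_(m.*2)) : R :=
  ((2 ^ m * m`!)%:R : rat)^-1 *:
    \sum_(s : 'S_(m.*2)) (-1) ^+ s *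
      \prod_(i < m) A (s (pair_fst i)) (s (pair_snd i)).
End Pfaffian.

(* The matrix has size l(lambda) rounded up to an even number; [nth 0]        *)
(* supplies the appended zero part.                                          *)
Definition Qmatrix (l : seq nat) : 'M[GammaQ]_((uphalf (size l)).*2) :=
  \matrix_(i, j)
    if (i < j)%N then Qpair (nth 0%N l i) (nth 0%N l j)
    else if (j < i)%N then - Qpair (nth 0%N l j) (nth 0%N l i)
    else 0.

Definition schurQ (l : seq nat) : GammaQ := pfaffian (Qmatrix l).

(* ------------------------------------------------------------------------ *)
(* Q(t,s) is the fraction field of Q[s][t]: the outer variable is t and the  *)
(* inner one is s.                                                           *)

Notation Qt := {fraction {poly rat}}.
Notation Qts := {fraction {poly {poly rat}}}.

Definition var_t : Qts := ('X : {poly {poly rat}})%:F.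
Definition var_s : Qts := (('X : {poly rat})%:P : {poly {poly rat}})%:F.

Definition rat_Qts (c : rat) : Qts := (c%:P%:P : {poly {poly rat}})%:F.

Definition schurQ_ts (l : seq nat) : Gamma Qts :=
  Gamma_extend rat_Qts (schurQ l).

Definition T_ts : Gamma Qts -> Gamma Qts :=
  Gamma_subst (fun n => ((1 - var_t ^+ n) / (1 - var_s ^+ n)) *: psum Qts n).

(* Since the Q_mu, mu in SP(N), are a basis, this determines C. *)
Definition is_transition (N : nat) (C : SP N -> SP N -> Qts) : Prop :=
  forall l : SP N, T_ts (schurQ_ts l) = \sum_(mu : SP N) C l mu *: schurQ_ts mu.

(* g(t) = f(t^M, t). Evaluating the outer variable of Q[s][t] at 'X^M leaves a *)
(* polynomial in the inner variable s, now renamed t.                        *)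
Definition specializes (M : nat) (f : Qts) (g : Qt) : Prop :=
  exists a b : {poly {poly rat}},
    [/\ b.['X^M] != 0, f = a%:F / b%:F & g = a.['X^M]%:F / b.['X^M]%:F].

Lemma specializes_fun (M : nat) (f : Qts) (g h : Qt) :
  specializes M f g -> specializes M f h -> g = h.
Proof.
have nz (p : {poly {poly rat}}) : p.['X^M] != 0 -> p%:F != 0 :> Qts.
  by rewrite tofrac_eq0; apply: contraNneq => ->; rewrite horner0.
case=> a [b [b0 -> ->]] [c [d [d0 eq_f ->]]].
apply/eqP; rewrite eqr_div ?tofrac_eq0 // -!tofracM tofrac_eq -!hornerM.
move/eqP: eq_f; rewrite eqr_div ?nz // -!tofracM tofrac_eq => /eqP <-.
by [].
Qed.

(* ------------------------------------------------------------------------ *)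

(* f(t^-1) *)
Definition eval_inv (f : {poly rat}) : Qt :=
  (map_poly (fun c : rat => (c%:P : {poly rat})%:F) f).[('X : {poly rat})%:F^-1].

Definition palindromic (d : nat) (f : {poly rat}) : Prop :=
  f%:F = ('X : {poly rat})%:F ^+ d * eval_inv f.

(* Main.v *)
(* The automorphism T_(t,s) is diagonal on the monomials in the p_n. Hence, if *)
(* A is a square matrix of coefficients of the Q_lambda at some family of      *)
(* monomials, C A = A D with D diagonal; as soon as A is invertible this gives *)
(* C = A D A^-1, and for t = s^M the entries of D are products of factors      *)
(* 1 + s^n + ... + s^((M-1)n), which are palindromic with constant term 1.     *)
(*   For 2^a b with b odd put g(2^a b) = p_b^(2^a), and let A have the columns *)
(* g(mu) = g(mu_1) g(mu_2)... for mu in SP(N). It is invertible for a 2-adic   *)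
(* reason: modulo 2 one has q_r / 2 = g(r), so the Pfaffian entries satisfy    *)
(* Q_(r,s) / 4 = g(r) g(s) + g(r+s), and since a Pfaffian is a sum over an odd *)
(* number of perfect matchings, 2^(-l(lambda)) Q_lambda is g(lambda) plus      *)
(* products of fewer than l(lambda) monomials g(c). Because g(c)^2 = g(2c) and *)
(* binary expansions are unique, such a product is never g(mu) with            *)
(* l(mu) >= l(lambda): modulo 2 the matrix A is unitriangular up to scaling.   *)
Require Import Defs.
From HB Require Import structures.
From mathcomp Require Import all_boot all_order all_fingroup all_algebra.
From mathcomp Require Import fraction finmap monalg.
From mathcomp Require Import zify ring.

Set Implicit Arguments.
Unset Strict Implicit.
Unset Printing Implicit Defensive.

Import GRing.Theory Num.Theory.
Local Open Scope ring_scope.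

(** * Reduction modulo 2 *)

#[local] Opaque fgmul fgscale fgadd.

(** Comparing coefficients at the monomials g(nu), nu in SP(N), in the relation that defines C gives
    C A = A D, where D_nu is the eigenvalue of T on g(nu) ([mcoeff_Gamma_subst],
    [transition_formula]). After specialisation a part r = 2^a b of nu contributes (1 + t^b + ... +
    t^((M-1)b))^(2^a), of darga (M-1)r, so every D_nu has darga (M-1)N ([palindromic_parts]). The
    entries of A D A^-1 combine the D_nu with constant coefficients and share this darga. At t = 0
    each D_nu is 1, so C becomes the identity; the top coefficient equals the constant one by
    [palindromic_coef].

    The substance is the invertibility of A, obtained in [schurQ_det] by scaling rows and reducing
    modulo 2. [half_mod2] computes q_r / 2 modulo 2, [pair_mod2] the normalised Q_(r,s), and
    [schurQ_mod2] the leading term of Q_lambda, where [pfaffian_cosets] and [odd_hyper_index] turn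
    the Pfaffian into a sum over an odd number of matchings. By [parts_monom_size] the error terms
    never meet a g(mu) with at least as many parts, so the residue matrix is unitriangular for the
    order by length. *)

Lemma mcoeff_msupp_sum (K L : comNzRingType) (g : Gamma K)
    (F : {cmonom nat} -> Gamma L) (w : {cmonom nat} -> L) m :
  (forall k, (F k)@_m = w k *+ (k == m)) -> (m \notin msupp g -> w m = 0) ->
  (\sum_(k <- msupp g) F k)@_m = w m.
Proof.
move=> Fw w0; rewrite raddf_sum /= (eq_bigr _ (fun k _ => Fw k)).
case: (boolP (m \in msupp g)) => [mg|mg]; last first.
  rewrite (w0 mg) big_seq big1 // => k kg.
  by case: eqVneq kg mg => [->->|].
rewrite (big_fsetD1 m) //= eqxx mulr1n [X in _ + X]big_seq [X in _ + X]big1.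
  by rewrite addr0.
by move=> k; rewrite in_fsetD1 => /andP[/negPf-> _]; rewrite mulr0n.
Qed.

Lemma mcoeff_Gamma_extend (K L : comNzRingType) (f : K -> L) (g : Gamma K) m :
  f 0 = 0 -> (Gamma_extend f g)@_m = f g@_m.
Proof.
move=> f0; apply: (mcoeff_msupp_sum (w := fun k => f g@_k)) => [k|mg].
  by rewrite mul_malgC mcoeffZ mcoeffU1 mulr_natr.
by rewrite (mcoeff_outdom mg).
Qed.

Opaque Gamma_extend.

Section GammaExtendMorphism.
Variables (K L : comNzRingType) (f : {rmorphism K -> L}).

Fact Gamma_extend_is_zmod_morphism : zmod_morphism (Gamma_extend f).
Proof.
move=> x y; apply/malgP => m.
have fE := mcoeff_Gamma_extend _ m (rmorph0 f).
by rewrite fE mcoeffB rmorphB -!fE -mcoeffB.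
Qed.

Fact Gamma_extend_is_monoid_morphism : monoid_morphism (Gamma_extend f).
Proof.
split=> [|x y]; apply/malgP => m.
  by rewrite mcoeff_Gamma_extend ?rmorph0 // !mcoeff1 rmorph_nat.
(* Coefficients may vanish under [f], so the product of the images is expanded over the supports of
   [x] and [y]. *)
have supp z : (msupp (Gamma_extend f z) `<=` msupp z)%fset.
  apply/fsubsetP => k; rewrite -mcoeff_neq0 mcoeff_Gamma_extend ?rmorph0 //.
  by apply: contraNT => /mcoeff_outdom ->; rewrite rmorph0.
rewrite mcoeff_Gamma_extend ?rmorph0 // (mcoeffMlw _ (supp x) (supp y)).
rewrite mcoeffMl rmorph_sum; apply: eq_bigr => k1 _; rewrite rmorph_sum.
apply: eq_bigr => k2 _; rewrite !mcoeff_Gamma_extend ?rmorph0 //.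
by rewrite raddfMn; congr (_ *+ _); apply: rmorphM.
Qed.

HB.instance Definition _ :=
  GRing.isZmodMorphism.Build (Gamma K) (Gamma L) (Gamma_extend f)
    Gamma_extend_is_zmod_morphism.
HB.instance Definition _ :=
  GRing.isMonoidMorphism.Build (Gamma K) (Gamma L) (Gamma_extend f)
    Gamma_extend_is_monoid_morphism.

Lemma Gamma_extend_monom m : Gamma_extend f << m >> = << m >>.
Proof.
apply/malgP => k.
by rewrite mcoeff_Gamma_extend ?rmorph0 // !mcoeffU1 rmorph_nat.
Qed.

End GammaExtendMorphism.

(* [mod2 iota pi x y] says that x lies in the localisation at 2 of the image *)
(* of A in R, and that its residue in the ring S of characteristic 2 is y.   *)
Section Mod2.
Variables (A R S : comNzRingType).
Variables (iota : {rmorphism A -> R}) (pi : {rmorphism A -> S}).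
Hypothesis S2 : 2 = 0 :> S.

Definition mod2 (x : R) (y : S) : Prop :=
  exists d a, [/\ odd d, x *+ d = iota a & y = pi a].

Lemma mulrn_odd2 (y : S) d : odd d -> y *+ d = y.
Proof.
move=> od; rewrite -[d]odd_double_half od -mul2n mulrnDr mulr1n mulrnA.
by rewrite -[y *+ 2]mulr_natl S2 mul0r mul0rn addr0.
Qed.

Lemma addrr2 (y : S) : y + y = 0.
Proof. by rewrite -mulr2n -mulr_natl S2 mul0r. Qed.

Lemma oppr2 (y : S) : - y = y.
Proof. by apply/eqP; rewrite eq_sym -addr_eq0 addrr2. Qed.

Lemma mod2_map a : mod2 (iota a) (pi a).
Proof. by exists 1%N, a. Qed.

Lemma mod2_0 : mod2 0 0.
Proof. by have := mod2_map 0; rewrite !rmorph0. Qed.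

Lemma mod2_1 : mod2 1 1.
Proof. by have := mod2_map 1; rewrite !rmorph1. Qed.

Lemma mod2D x1 y1 x2 y2 : mod2 x1 y1 -> mod2 x2 y2 -> mod2 (x1 + x2) (y1 + y2).
Proof.
move=> [d1 [a1 [o1 e1 ->]]] [d2 [a2 [o2 e2 ->]]].
exists (d1 * d2)%N, (a1 *+ d2 + a2 *+ d1); split; first by rewrite oddM o1.
  by rewrite mulrnDl mulrnA e1 mulnC mulrnA e2 rmorphD !rmorphMn.
by rewrite rmorphD !rmorphMn !mulrn_odd2.
Qed.

Lemma mod2M x1 y1 x2 y2 : mod2 x1 y1 -> mod2 x2 y2 -> mod2 (x1 * x2) (y1 * y2).
Proof.
move=> [d1 [a1 [o1 e1 ->]]] [d2 [a2 [o2 e2 ->]]].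
exists (d1 * d2)%N, (a1 * a2); split; rewrite ?oddM ?o1 ?rmorphM //.
by rewrite -e1 -e2 mulrnAr mulrnAl -mulrnA.
Qed.

Lemma mod2N x y : mod2 x y -> mod2 (- x) y.
Proof.
move=> [d [a [od e ->]]]; exists d, (- a); split => //.
  by rewrite mulNrn e rmorphN.
by rewrite rmorphN oppr2.
Qed.

Lemma mod2_sign n x y : mod2 x y -> mod2 ((-1) ^+ n * x) y.
Proof.
by rewrite -signr_odd; case: (odd n); rewrite ?mulN1r ?mul1r // => /mod2N.
Qed.

Lemma mod2_double x y : mod2 x y -> mod2 (x *+ 2) 0.
Proof. by move=> xy; rewrite mulr2n -(addrr2 y); apply: mod2D. Qed.

Lemma mod2_sum I (r : seq I) (P : pred I) (F : I -> R) (G : I -> S) :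
  (forall i, P i -> mod2 (F i) (G i)) ->
  mod2 (\sum_(i <- r | P i) F i) (\sum_(i <- r | P i) G i).
Proof.
move=> FG; elim/big_rec2: _ => [|i y x Pi]; first exact: mod2_0.
exact/mod2D/FG.
Qed.

Lemma mod2_sum0 I (r : seq I) (P : pred I) (F : I -> R) :
  (forall i, P i -> mod2 (F i) 0) -> mod2 (\sum_(i <- r | P i) F i) 0.
Proof. by move=> /(mod2_sum r); rewrite big1_eq. Qed.

Lemma mod2_prod I (r : seq I) (P : pred I) (F : I -> R) (G : I -> S) :
  (forall i, P i -> mod2 (F i) (G i)) ->
  mod2 (\prod_(i <- r | P i) F i) (\prod_(i <- r | P i) G i).
Proof.
move=> FG; elim/big_rec2: _ => [|i y x Pi]; first exact: mod2_1.
exact/mod2M/FG.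
Qed.

(** An odd integer is a unit in the localisation at 2 and has residue 1, so it can be divided
    out. *)
Lemma mod2_odd d x y : odd d -> mod2 (x *+ d) y -> mod2 x y.
Proof.
move=> od [d' [a [od' e ->]]]; exists (d * d')%N, a.
by rewrite oddM od mulrnA.
Qed.

Lemma mod2_det n (B : 'M[R]_n) (b : 'M[S]_n) :
  (forall i j, mod2 (B i j) (b i j)) -> mod2 (\det B) (\det b).
Proof.
move=> Bb; apply: mod2_sum => s _.
rewrite -[X in mod2 _ X]mul1r.
have -> : (-1) ^+ s = 1 :> S by case: (odd_perm s); rewrite ?expr1 ?oppr2.
rewrite !mul1r; apply: mod2_sign; exact: mod2_prod.
Qed.

End Mod2.

Notation rat_mod2 :=
  (@mod2 int rat 'F_2 (intmul 1 : {rmorphism int -> rat})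
    (intmul 1 : {rmorphism int -> 'F_2})).
Notation Gamma_mod2 :=
  (@mod2 (Gamma int) GammaQ (Gamma 'F_2)
    (Gamma_extend (intmul 1 : int -> rat))
    (Gamma_extend (intmul 1 : int -> 'F_2))).

(** Since Z embeds in Q, [x] = 0 forces the integer numerator to vanish; hence a determinant may be
    tested modulo 2. *)
Lemma rat_mod2_neq0 x y : rat_mod2 x y -> y != 0 -> x != 0.
Proof.
move=> [d [a [od /= e ->]]]; apply: contraNneq => x0.
move: e; rewrite x0 mul0rn => /esym/eqP; rewrite intr_eq0 => /eqP->.
by rewrite rmorph0.
Qed.

Lemma Gamma_mod2_coeff x y m : Gamma_mod2 x y -> rat_mod2 x@_m y@_m.
Proof.
move=> [d [a [od e ->]]]; exists d, a@_m; split=> //=.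
  by rewrite -mcoeffMn e mcoeff_Gamma_extend.
by rewrite mcoeff_Gamma_extend.
Qed.

Lemma Gamma_mod2_monom m : Gamma_mod2 << m >> << m >>.
Proof.
by exists 1%N, << m >>; split; rewrite /= ?mulr1n ?Gamma_extend_monom.
Qed.

Lemma GammaF2_2 : 2 = 0 :> Gamma 'F_2.
Proof.
apply/malgP => m; rewrite mcoeffMn mcoeff0 -mulr_natr.
by rewrite [2%:R](_ : _ = 0) ?mulr0 //; apply/val_inj.
Qed.

(** * The monomials g(lambda) *)

Section PartMonomials.
Local Open Scope nat_scope.
(* Writing r = 2^a (2i+1), this is the monomial p_(2i+1)^(2^a). *)
Definition part_monom (r : nat) : {cmonom nat} :=
  if r is 0 then mone else iter (2 ^ logn 2 r) (mmul (ucm (r`_2^')./2)) mone.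

Definition parts_monom (c : seq nat) : {cmonom nat} :=
  \big[mmul/mone]_(r <- c) part_monom r.

Lemma part_monomE r i : (0 < r)%N ->
  part_monom r i = ((r`_2^' == i.*2.+1) * 2 ^ logn 2 r)%N.
Proof.
move=> r_gt0; rewrite /part_monom; case: r r_gt0 => // r _.
have -> : (r.+1`_2^' == i.*2.+1) = ((r.+1`_2^')./2 == i).
  have od : odd (r.+1`_2^') by rewrite odd_2'nat part_pnat.
  rewrite -[in LHS](odd_double_half (r.+1`_2^')) od add1n eqSS.
    by rewrite -!muln2 eqn_pmul2r.
elim: (2 ^ _)%N => [|n IHn]; first by rewrite /= cm1 muln0.
by rewrite iterS cmM cmU IHn mulnS.
Qed.

Lemma part_monom_double r : part_monom r.*2 = mmul (part_monom r) (part_monom r).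
Proof.
case: (posnP r) => [->|r_gt0]; first by rewrite mul1m.
apply/eqP/cmP => i; rewrite cmM !part_monomE ?double_gt0 //.
have -> : (r.*2)`_2^' = r`_2^' :> nat by rewrite -mul2n partnM // part_p'nat ?mul1n.
rewrite -(mul2n r) lognM // logn_prime // eqxx add1n expnS.
by case: eqP => _; rewrite ?mul1n ?mul0n // mul2n addnn.
Qed.

Lemma parts_monomE c i : all (leq 1) c ->
  parts_monom c i = (\sum_(r <- c | r`_2^' == i.*2.+1) 2 ^ logn 2 r)%N.
Proof.
rewrite /parts_monom; elim: c => [_|r c IHc /= /andP[r_gt0 /IHc e]].
  by rewrite !big_nil cm1.
by rewrite !big_cons cmM e part_monomE //; case: eqP; rewrite ?mul1n.
Qed.

Lemma parts_monom_cat c d :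
  parts_monom (c ++ d) = mmul (parts_monom c) (parts_monom d).
Proof. exact: big_cat. Qed.

(** The lowest digit is the parity of the sum; removing it and halving leaves one digit fewer. *)
Lemma binary_uniq (K : nat) (x y : nat -> bool) :
  (\sum_(a < K) x a * 2 ^ a = \sum_(a < K) y a * 2 ^ a)%N ->
  forall a, (a < K)%N -> x a = y a.
Proof.
elim: K x y => // K IHK x y; rewrite !big_ord_recl /= !muln1.
have dbl (z : nat -> bool) :
    (\sum_(i < K) z (bump 0 i) * 2 ^ bump 0 i
     = (\sum_(i < K) z i.+1 * 2 ^ i).*2)%N.
  by rewrite -mul2n big_distrr /=; apply: eq_bigr => i _; rewrite expnS mulnCA.
rewrite !dbl => e.
have xy0 : x 0 = y 0.
  move/(congr1 odd): e; rewrite !oddD !odd_double.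
  by case: (x 0); case: (y 0).
move: e; rewrite xy0 => /addnI/double_inj/(IHK (x \o S) (y \o S)) IH [|a] //.
exact: IH.
Qed.

Lemma sum_pow2_inj (c d : seq nat) : uniq c -> uniq d ->
  (\sum_(a <- c) 2 ^ a = \sum_(a <- d) 2 ^ a)%N -> c =i d.
Proof.
move=> uc ud e; set K := (maxn (\max_(a <- c) a) (\max_(a <- d) a)).+1.
have bd s : (\max_(a <- s) a < K)%N -> uniq s ->
    (\sum_(a <- s) 2 ^ a = \sum_(a < K) ((a : nat) \in s) * 2 ^ a)%N.
  move=> sK us; rewrite -(big_mkord xpredT (fun a : nat => (a \in s) * 2 ^ a))%N.
  rewrite [RHS](eq_bigr (fun a : nat => if a \in s then 2 ^ a else 0)); last first.
    by move=> a _; case: (a \in s); rewrite /= ?mul1n ?mul0n.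
  rewrite -big_mkcond -[RHS]big_filter; apply: perm_big; apply: uniq_perm => //.
    exact/filter_uniq/iota_uniq.
  move=> a; rewrite mem_filter mem_index_iota /=.
  case: (boolP (a \in s)) => //= as_; apply/esym.
  by apply: leq_ltn_trans sK; apply: leq_bigmax_seq.
have cK : (\max_(a <- c) a < K)%N by rewrite ltnS leq_maxl.
have dK : (\max_(a <- d) a < K)%N by rewrite ltnS leq_maxr.
move: e; rewrite bd // (bd d) // => /(binary_uniq (x := mem c) (y := mem d)) e a.
case: (ltnP a K) => [/e //|Ka].
have out s : (\max_(b <- s) b < K)%N -> a \in s = false.
  move=> sK; apply: contraTF Ka => as_; rewrite -ltnNge.
  by apply: leq_ltn_trans sK; apply: leq_bigmax_seq.
by rewrite !out.
Qed.

Lemma eq_part2 r s : (0 < r)%N -> (0 < s)%N ->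
  r`_2^' = s`_2^' -> logn 2 r = logn 2 s -> r = s.
Proof.
by move=> r0 s0 e1 e2; rewrite -(partnC 2 r0) -(partnC 2 s0) e1 !p_part e2.
Qed.

(** The exponent of p_(2i+1) is the sum of 2^a over the parts 2^a (2i+1). Distinct parts have
    distinct a, so the binary expansion of this exponent recovers them. *)
Lemma parts_monom_inj c d : all (leq 1) c -> all (leq 1) d ->
  uniq c -> uniq d -> parts_monom c = parts_monom d -> c =i d.
Proof.
have half c' d' r : all (leq 1) c' -> all (leq 1) d' -> uniq c' -> uniq d' ->
    parts_monom c' = parts_monom d' -> r \in c' -> r \in d'.
  move=> c1 d1 uc ud e rc; have r_gt0 := allP c1 r rc.
  set i := (r`_2^')./2; have ri : r`_2^' = i.*2.+1.
    by rewrite -[LHS]odd_double_half odd_2'nat part_pnat.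
  pose bits s := [seq logn 2 x | x <- s & x`_2^' == i.*2.+1].
  have ub s : all (leq 1) s -> uniq s -> uniq (bits s).
    move=> s1 us; rewrite map_inj_in_uniq ?filter_uniq // => x y.
    rewrite !mem_filter => /andP[/eqP xi xs] /andP[/eqP yi ys].
    by apply: eq_part2; rewrite ?(allP s1) // xi yi.
  have eb : bits c' =i bits d'.
    apply: sum_pow2_inj; [exact: ub|exact: ub|].
    by rewrite !big_map !big_filter -!parts_monomE // e.
  have /mapP[s] : logn 2 r \in bits d'.
    by rewrite -eb map_f // mem_filter rc ri eqxx.
  rewrite mem_filter => /andP[/eqP si sd] e2.
  by rewrite (eq_part2 (s := s) r_gt0) ?(allP d1) // ri si.
move=> c1 d1 uc ud e r; apply/idP/idP; [exact: half e|exact: half (esym e)].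
Qed.

(** A repeated part x, x is replaced by the single part 2x, which keeps the monomial because g(x)^2
    = g(2x); the length drops each time. *)
Lemma merge_parts c : all (leq 1) c -> exists d,
  [/\ all (leq 1) d, uniq d, (size d <= size c)%N
    & parts_monom d = parts_monom c].
Proof.
have [n] := ubnP (size c); elim: n c => // n IHn c; rewrite ltnS => cn c1.
case: (boolP (uniq c)) => [uc|/(uniqPn 0)[i [j [ij jc e]]]]; first by exists c.
set x := nth 0 c i in e.
have x_c : x \in c by rewrite mem_nth // (ltn_trans ij).
have pc := perm_to_rem x_c.
(* [x] occurs at least twice: at position [i] before [j], and at position [j]. *)
have x_r : x \in rem x c.
  rewrite -has_pred1 has_count -(ltn_add2l 1).
  have /seq.permP/(_ (pred1 x)) /= := pc; rewrite eqxx => <-.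
  rewrite -(cat_take_drop j c) count_cat.
  apply: (@leq_add 1 1); rewrite -has_count has_pred1; last first.
    by rewrite (drop_nth 0) // inE -e eqxx.
  by rewrite -[x](nth_take 0 ij) mem_nth // size_take jc.
set c' := rem x (rem x c).
have {}pc : perm_eq c [:: x, x & c'].
  by rewrite (perm_trans pc) // perm_cons perm_to_rem.
have x0 : 0 < x := allP c1 x x_c.
have c'1 : all (leq 1) c'.
  by have := perm_all (leq 1) pc; rewrite c1 /= => /esym/and3P[].
case: (IHn (x.*2 :: c')) => [||d [d1 ud sd ed]].
- by have := perm_size pc; rewrite /= => e1; rewrite -ltnS -e1.
- by rewrite /= double_gt0 x0.
exists d; split=> //.
  by rewrite (leq_trans sd) // (perm_size pc).
rewrite ed /parts_monom (perm_big _ pc) /= !big_cons part_monom_double.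
by rewrite mulmA.
Qed.

Lemma strict_partition_uniq N l : strict_partition N l -> uniq l.
Proof.
case/and3P=> sl _ _; apply: sorted_uniq sl => [y x z /= xy yz|x /=].
  exact: ltn_trans yz xy.
by rewrite ltnn.
Qed.

Lemma strict_parts_monom_inj N (l l' : seq nat) :
  strict_partition N l -> strict_partition N l' ->
  parts_monom l = parts_monom l' -> l = l'.
Proof.
move=> hl hl' e; have [ul ul'] := (strict_partition_uniq hl, strict_partition_uniq hl').
have [/and3P[sl l1 _] /and3P[sl' l1' _]] := (hl, hl').
apply: (irr_sorted_eq _ _ sl sl').
- by move=> y x z /= xy yz; apply: ltn_trans yz xy.
- by move=> x /=; rewrite ltnn.
exact: parts_monom_inj.
Qed.

(* Merging equal parts shortens a list without changing its monomial. *)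
Lemma parts_monom_size c d : all (leq 1) c -> all (leq 1) d -> uniq d ->
  parts_monom c = parts_monom d -> size d <= size c.
Proof.
move=> c1 d1 ud e; have [c' [c'1 uc' sc' ec']] := merge_parts c1.
have {}e : c' =i d by apply: parts_monom_inj; rewrite ?ec'.
by rewrite -(perm_size (uniq_perm uc' ud e)).
Qed.

End PartMonomials.

(** * Pfaffians as sums over matchings *)

Section PfaffianCosets.
Variable m : nat.
Implicit Types (i j : 'I_m) (k : 'I_(m.*2)) (b : bool).

(** Coordinates on the matrix indices: 2i + b is the pair i together with a side b, recovered by
    [pair_index] and [odd]. *)
Definition pair_elt i b : 'I_(m.*2) := if b then pair_snd i else pair_fst i.

Arguments pair_elt : simpl never.

Fact pair_index_subproof k : (k./2 < m)%N.
Proof.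
rewrite -ltn_double (leq_ltn_trans _ (ltn_ord k)) //.
by rewrite -[X in (_ <= X)%N]odd_double_half leq_addl.
Qed.

Definition pair_index k : 'I_m := Ordinal (pair_index_subproof k).

Lemma pair_eltK i b : pair_index (pair_elt i b) = i.
Proof. by apply: val_inj; case: b; rewrite /= ?uphalf_double ?doubleK. Qed.

Lemma odd_pair_elt i b : odd (pair_elt i b) = b.
Proof. by case: b; rewrite /= odd_double. Qed.

Lemma pair_elt_index k : pair_elt (pair_index k) (odd k) = k.
Proof.
by apply: val_inj; rewrite -[RHS]odd_double_half; case: (odd k).
Qed.

Lemma pair_elt_inj b : injective (pair_elt^~ b).
Proof. by move=> i j /(congr1 pair_index); rewrite !pair_eltK. Qed.

Lemma pair_elt_neq i j b : pair_elt i b != pair_elt j (~~ b).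
Proof.
by apply/eqP => /(congr1 (fun k : 'I__ => odd k)); rewrite !odd_pair_elt; case: b.
Qed.

Lemma pair_permP (s t : 'S_(m.*2)) :
  (forall i b, s (pair_elt i b) = t (pair_elt i b)) -> s = t.
Proof. by move=> st; apply/permP => k; rewrite -(pair_elt_index k). Qed.

(* The hyperoctahedral group: permutations permuting the pairs {2i, 2i+1}. *)
Definition hyper_fun (x : {ffun 'I_m -> bool} * 'S_m) k :=
  pair_elt (x.2 (pair_index k)) (odd k (+) x.1 (pair_index k)).

Fact hyper_fun_inj x : injective (hyper_fun x).
Proof.
move=> k k' e; have := congr1 pair_index e; rewrite !pair_eltK => /perm_inj ei.
have := congr1 (fun k : 'I__ => odd k) e; rewrite !odd_pair_elt ei => /addIb eo.
by rewrite -(pair_elt_index k) ei eo pair_elt_index.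
Qed.

Definition hyper x : 'S_(m.*2) := perm (@hyper_fun_inj x).

Lemma hyperE x i b : hyper x (pair_elt i b) = pair_elt (x.2 i) (b (+) x.1 i).
Proof. by rewrite permE /hyper_fun pair_eltK odd_pair_elt. Qed.

Lemma hyperM x y :
  (hyper x * hyper y)%g =
  hyper ([ffun i => x.1 i (+) y.1 (x.2 i)], (x.2 * y.2)%g).
Proof.
by apply: pair_permP => i b; rewrite permM !hyperE /= ffunE permM addbA.
Qed.

Lemma hyper_inj : injective hyper.
Proof.
move=> [f s] [g t] e.
have E i : pair_elt (s i) (f i) = pair_elt (t i) (g i).
  by have := congr1 (fun u : 'S__ => u (pair_elt i false)) e; rewrite !hyperE.
congr (_, _); [apply/ffunP|apply/permP] => i.
  by have := congr1 (fun k : 'I__ => odd k) (E i); rewrite !odd_pair_elt.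
by have := congr1 pair_index (E i); rewrite !pair_eltK.
Qed.

Definition hyper_set : {set 'S_(m.*2)} := [set hyper x | x in [set: _]].

Fact hyper_set_group : group_set hyper_set.
Proof.
apply/group_setP; split=> [|_ _ /imsetP[x _ ->] /imsetP[y _ ->]]; last first.
  by rewrite hyperM imset_f.
have -> : 1%g = hyper ([ffun=> false], 1%g); last by rewrite imset_f.
by apply: pair_permP => i b; rewrite hyperE /= ffunE !perm1 addbF.
Qed.

Definition hyper_group := Group hyper_set_group.

Lemma card_hyper : #|hyper_group| = (2 ^ m * m`!)%N.
Proof.
rewrite card_imset ?cardsT; last exact: hyper_inj.
by rewrite card_prod card_ffun card_bool card_ord card_Sn.
Qed.

(** Swapping two whole pairs is a product of two transpositions, one on each side, hence even. *)
Lemma odd_hyper_perm s : odd_perm (hyper ([ffun=> false], s)) = false.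
Proof.
have [ts -> dts] := prod_tpermP s; elim: ts dts {s} => [_|[i j] ts IH /=].
  rewrite big_nil (_ : hyper _ = 1%g) ?odd_perm1 //.
  by apply: pair_permP => i b; rewrite hyperE /= ffunE !perm1 addbF.
move=> /andP[ij /IH {}IH]; rewrite big_cons /=.
set u := tperm i j; set v := (\prod_(t <- ts) _)%g in IH *.
have -> : hyper ([ffun=> false], (u * v)%g)
    = (hyper ([ffun=> false], u) * hyper ([ffun=> false], v))%g.
  by rewrite hyperM; congr (hyper (_, _)); apply/ffunP => k; rewrite !ffunE.
rewrite odd_permM {}IH addbF.
have -> : hyper ([ffun=> false], u) =
    (tperm (pair_elt i false) (pair_elt j false) *
     tperm (pair_elt i true) (pair_elt j true))%g.
  apply: pair_permP => k b; rewrite hyperE /= ffunE addbF permM.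
  case: b.
    rewrite [X in _ = tperm _ _ X]tpermD ?(pair_elt_neq _ k false) //.
    by rewrite -(inj_tperm _ _ _ (@pair_elt_inj true)).
  rewrite -(inj_tperm _ _ _ (@pair_elt_inj false)) [RHS]tpermD ?(pair_elt_neq _ _ true) //.
by rewrite odd_permM !odd_tperm !(inj_eq (@pair_elt_inj _)) addbb.
Qed.

(** Each flipped pair is one transposition; induction on the number of flipped pairs. *)
Lemma sign_hyper_swap (R : comNzRingType) (f : {ffun 'I_m -> bool}) :
  (-1) ^+ hyper (f, 1%g) = \prod_i (-1) ^+ f i :> R.
Proof.
have [n] := ubnP #|[pred i | f i]|; elim: n f => // n IHn f; rewrite ltnS => fn.
case: (pickP [pred i | f i]) => [i fi|f0]; last first.
  have {}f0 i : f i = false := f0 i.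
  rewrite big1 => [|i _]; last by rewrite f0.
  rewrite (_ : f = [ffun=> false]) ?odd_hyper_perm //.
  by apply/ffunP => i; rewrite f0 ffunE.
have {}fi : f i = true := fi.
pose g := [ffun j => (j != i) && f j].
have gi : g i = false by rewrite ffunE eqxx.
have gj j : j != i -> g j = f j by rewrite ffunE => ->.
have -> : hyper (f, 1%g) =
    (tperm (pair_elt i false) (pair_elt i true) * hyper (g, 1%g))%g.
  apply: pair_permP => j b; rewrite permM.
  have [-> | ji] := eqVneq j i.
    case: b; rewrite ?tpermL ?tpermR !hyperE /= fi gi //.
  rewrite tpermD ?hyperE /= ?gj //.
    by apply: contra_neq ji => /(congr1 pair_index); rewrite !pair_eltK.
  by apply: contra_neq ji => /(congr1 pair_index); rewrite !pair_eltK.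
rewrite odd_permM odd_tperm (pair_elt_neq i i false) signr_addb IHn; last first.
  apply: leq_trans fn; apply: proper_card; apply/properP; split.
    by apply/subsetP => j; rewrite !inE ffunE => /andP[].
  by exists i; rewrite !inE ?gi ?fi.
rewrite (bigD1 i) //= gi mul1r [RHS](bigD1 i) //= fi.
by congr (_ * _); apply: eq_bigr => j ji; rewrite gj.
Qed.

Lemma sign_hyper (R : comNzRingType) x :
  (-1) ^+ hyper x = \prod_i (-1) ^+ x.1 i :> R.
Proof.
have -> : hyper x = (hyper (x.1, 1%g) * hyper ([ffun=> false], x.2))%g.
  rewrite hyperM /= mul1g; case: x => f s; congr (hyper (_, _)).
  by apply/ffunP => i; rewrite !ffunE addbF.
by rewrite odd_permM odd_hyper_perm addbF sign_hyper_swap.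
Qed.

Section Terms.
Variables (R : comAlgType rat) (A : 'M[R]_(m.*2)).
Hypothesis A_anti : forall k l, A k l = - A l k.

Definition pfaffian_term (s : 'S_(m.*2)) : R :=
  (-1) ^+ s * \prod_(i < m) A (s (pair_fst i)) (s (pair_snd i)).

(** Flipping a pair changes the sign of the permutation and, by antisymmetry, that of one entry;
    permuting pairs is even and only reorders the product. *)
Lemma pfaffian_term_hyper x s :
  pfaffian_term (hyper x * s)%g = pfaffian_term s.
Proof.
rewrite /pfaffian_term odd_permM signr_addb sign_hyper -mulrA mulrCA.
congr (_ * _); rewrite -big_split [RHS](reindex_inj (@perm_inj _ x.2)) /=.
apply: eq_bigr => i _; rewrite !permM.
rewrite (hyperE x i false) (hyperE x i true) /= /pair_elt.
by case: (x.1 i); rewrite ?mul1r // A_anti mulN1r opprK.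
Qed.

(** A coset of the hyperoctahedral group is a perfect matching, and the prefactor of the Pfaffian is
    the inverse of the order of that group. *)
Lemma pfaffian_cosets :
  pfaffian A = \sum_(D in rcosets hyper_group [set: _]) pfaffian_term (repr D).
Proof.
rewrite /pfaffian.
have -> : \sum_(s : 'S_(m.*2)) pfaffian_term s =
    (2 ^ m * m`!)%:R *
      \sum_(D in rcosets hyper_group [set: _]) pfaffian_term (repr D).
  rewrite (eq_bigl (fun s => s \in [set: 'S_(m.*2)])) => [|s]; last by rewrite inE.
  rewrite (set_partition_big _ (rcosets_partition (subsetT hyper_group))) mulr_sumr.
  apply: eq_bigr => D /rcosetsP[t _ ->].
  have /esym e := rcoset_repr hyper_group t; move: e; set r := repr _ => ->.
  rewrite (eq_bigr (fun=> pfaffian_term r)).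
    by rewrite sumr_const card_rcoset card_hyper mulr_natl.
  by move=> _ /rcosetP[_ /imsetP[x _ ->] ->]; apply: pfaffian_term_hyper.
rewrite mulr_natl -scaler_nat scalerA mulVf ?scale1r //.
by rewrite pnatr_eq0 -lt0n muln_gt0 expn_gt0 fact_gt0.
Qed.

End Terms.

Lemma odd_hyper_index : odd #|rcosets hyper_group [set: 'S_(m.*2)]|.
Proof.
(* [d] is the double factorial (2m-1)!!, a product of odd numbers. *)
have [d od e] : exists2 d, odd d & (m.*2`! = 2 ^ m * m`! * d)%N.
  elim: m => [|n [d od e]]; first by exists 1%N.
  exists (d * n.*2.+1)%N; first by rewrite oddM od /= odd_double.
  by rewrite doubleS !factS e -doubleS -mul2n expnS; lia.
have := Lagrange (subsetT hyper_group).
rewrite cardsT card_Sn e card_hyper => /eqP.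
by rewrite eqn_pmul2l ?muln_gt0 ?expn_gt0 ?fact_gt0 // => /eqP ix; rewrite -ix in od.
Qed.

End PfaffianCosets.

(** * The functions q_r *)

Lemma coef_expr_eq (R : nzRingType) (p q : {poly R}) n :
  (forall j, (j <= n)%N -> p`_j = q`_j) ->
  forall k j, (j <= n)%N -> (p ^+ k)`_j = (q ^+ k)`_j.
Proof.
move=> pq; elim=> [|k IHk] j jn; first by rewrite !expr0.
rewrite !exprS !coefM; apply: eq_bigr => i _.
by rewrite pq ?IHk // (leq_trans _ jn) ?leq_subr // -ltnS.
Qed.

Lemma coef_expr_low (R : nzRingType) (p : {poly R}) :
  p`_0 = 0 -> forall k j, (j < k)%N -> (p ^+ k)`_j = 0.
Proof.
move=> p0; elim=> // k IHk j jk; rewrite exprS coefM big1 // => i _.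
case: (posnP i) => [->|i0]; first by rewrite p0 mul0r.
by rewrite IHk ?mulr0 //; have := ltn_ord i; lia.
Qed.

Lemma coef_log_qseries r j : (log_qseries r)`_j =
  if odd j && (j <= r)%N then 2 *: ((j%:R : rat)^-1 *: psum rat j) else 0.
Proof.
rewrite /log_qseries coef_sum.
rewrite (eq_bigr (fun i : 'I_r.+1 => if i == j :> nat then
    2 *: ((i%:R : rat)^-1 *: psum rat i) else 0)); last first.
  by move=> i _; rewrite coefCM coefXn eq_sym; case: eqP => _; rewrite ?mulr1 ?mulr0.
rewrite -big_mkcondr -ltnS; case: (ltnP j r.+1) => [jr|rj]; last first.
  rewrite andbF big1 // => i /andP[_ /eqP ij].
  by have := ltn_ord i; rewrite ij ltnNge rj.
rewrite andbT; case: ifP => oj.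
  rewrite (big_pred1 (Ordinal jr)) // => i /=.
  by rewrite -val_eqE /=; case: eqP => [->|_]; rewrite ?oj ?andbF.
by rewrite big1 // => i /andP[oi /eqP ij]; rewrite ij oj in oi.
Qed.

#[local] Opaque log_qseries.

(** The truncations in [qfun] are harmless: terms of degree above [s] and powers of exponent above
    [s] do not reach the coefficient of z^s. *)
Lemma qfun_widen s r K : (s <= r)%N -> (s < K)%N ->
  \sum_(k < K) (k`!%:R : rat)^-1 *: (log_qseries r ^+ k)`_s = qfun s.
Proof.
move=> sr sK; rewrite /qfun.
rewrite [RHS](big_ord_widen K
  (fun k => (k`!%:R : rat)^-1 *: (log_qseries s ^+ k)`_s) sK).
rewrite [RHS]big_mkcond; apply: eq_bigr => k _; rewrite ltnS.
case: (leqP k s) => [ks|sk]; last first.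
  by rewrite coef_expr_low ?scaler0 // coef_log_qseries.
congr (_ *: _); apply: (@coef_expr_eq _ _ _ s) => // j js.
by rewrite !coef_log_qseries js (leq_trans js sr).
Qed.

Lemma qfun0 : qfun 0 = 1.
Proof. by rewrite /qfun big_ord1 expr0 coef1 invr1 scale1r. Qed.

(* From q'(z) = q(z) (2 sum_(n odd) p_n z^(n-1)). *)
Lemma qfun_newton r : r.+1%:R *: qfun r.+1 =
  \sum_(i < r.+1 | ~~ odd i) 2 *: (psum rat i.+1 * qfun (r - i)).
Proof.
pose L := log_qseries r.+1.
have L1 (i : 'I_r.+1) : L^`()`_i = if odd i then 0 else 2 *: psum rat i.+1.
  rewrite coef_deriv coef_log_qseries /= ltn_ord andbT.
  case: (odd i); rewrite /= ?mul0rn //.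
  by rewrite -scaler_nat !scalerA mulrCA mulfV ?mulr1 // pnatr_eq0.
have -> : qfun r.+1 =
    \sum_(k < r.+1) ((k.+1)`!%:R : rat)^-1 *: (L ^+ k.+1)`_r.+1.
  by rewrite /qfun big_ord_recl expr0 coef1 scaler0 add0r.
rewrite [LHS]scaler_sumr.
rewrite [LHS](eq_bigr (fun k : 'I_r.+1 => \sum_(i < r.+1 | ~~ odd i)
    2 *: (psum rat i.+1 * ((k`!%:R : rat)^-1 *: (L ^+ k)`_(r - i))))); last first.
  move=> k _; rewrite scalerA.
  have -> : (L ^+ k.+1)`_r.+1 = (r.+1%:R : rat)^-1 *: ((L ^+ k.+1)^`()`_r).
    by rewrite coef_deriv -scaler_nat scalerA mulVf ?scale1r // pnatr_eq0.
  rewrite deriv_exp coefMn coefM -scaler_nat !scalerA.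
  have -> : r.+1%:R * ((k.+1)`!%:R)^-1 * (r.+1%:R)^-1 * k.+1%:R = (k`!%:R : rat)^-1.
    rewrite factS natrM; field.
    by rewrite !nat1r !pnatr_eq0 -lt0n fact_gt0.
  rewrite scaler_sumr [RHS]big_mkcond; apply: eq_bigr => i _; rewrite L1.
  case: (odd i) => /=; first by rewrite mul0r scaler0.
  by rewrite -scalerAl -scalerAr !scalerA mulrC.
rewrite exchange_big; apply: eq_bigr => i _ /=.
rewrite -scaler_sumr -mulr_sumr (@qfun_widen (r - i) r.+1) //.
  by rewrite (leq_trans (leq_subr _ _)).
by rewrite ltnS leq_subr.
Qed.

#[local] Opaque qfun.

(* q(z) q(-z) = 1: the derivative vanishes since w = q'/q is even. *)
Lemma newton_quadratic (R : comAlgType rat) (q w : nat -> R) :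
  (forall k, ~~ odd k -> w k = 0) ->
  (forall r, r%:R *: q r = \sum_(k < r.+1) w k * q (r - k)%N) ->
  forall n, (0 < n)%N ->
  \sum_(i < n.+1) (-1) ^+ i * (q i * q (n - i)%N) = 0.
Proof.
move=> w0 N n n0.
(* Writing n = i + (n - i), Newton's recurrence is applied to [q i] in [S1] and to [q (n - i)] in
   [S2]. *)
pose S1 := \sum_(i < n.+1) \sum_(k < n.+1 | (k < i.+1)%N)
  (-1) ^+ i * (w k * (q (i - k)%N * q (n - i)%N)).
pose S2 := \sum_(i < n.+1) \sum_(k < n.+1 | (k < (n - i).+1)%N)
  (-1) ^+ i * (w k * (q i * q (n - i - k)%N)).
have E : n%:R *: \sum_(i < n.+1) (-1) ^+ i * (q i * q (n - i)%N) = S1 + S2.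
  rewrite scaler_sumr -big_split; apply: eq_bigr => i _ /=.
  have i_n : (i <= n)%N by rewrite -ltnS.
  rewrite -[in X in X%:R](subnKC i_n) natrD scalerDl; congr (_ + _).
    rewrite scalerAr scalerAl N (big_ord_widen n.+1 (fun k => w k * q (i - k)%N)) //.
    rewrite mulr_suml mulr_sumr.
    by apply: eq_bigr => k _; rewrite -(mulrA (w k)).
  rewrite scalerAr scalerAr N (big_ord_widen n.+1 (fun k => w k * q (n - i - k)%N)).
    by rewrite !mulr_sumr; apply: eq_bigr => k _; rewrite (mulrCA (q i)).
  by rewrite ltnS leq_subr.
suff S12 : S1 + S2 = 0.
  move/(congr1 ( *:%R (n%:R : rat)^-1)): E.
  by rewrite S12 scaler0 scalerA mulVf ?scale1r // pnatr_eq0 -lt0n.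
(* For fixed k, shifting i by k in [S1] yields the terms of [S2] times (-1)^k: they cancel for k
   odd, and [w k] = 0 for k even. *)
rewrite /S1 (exchange_big_dep xpredT) //= /S2 [X in _ + X](exchange_big_dep xpredT) //=.
rewrite -big_split big1 // => k _ /=; have k_n : (k <= n)%N by rewrite -ltnS.
rewrite (eq_bigl (fun i : 'I_n.+1 => (k <= i)%N)) //.
rewrite -(big_geq_mkord k n.+1 xpredT
  (fun i => (-1) ^+ i * (w k * (q (i - k)%N * q (n - i)%N)))).
rewrite -{1}[k : nat]add0n big_addn big_mkord.
rewrite [X in _ + X](eq_bigl (fun i : 'I_n.+1 => (i < n.+1 - k)%N)); last first.
  by move=> i; have := ltn_ord i; lia.
rewrite -(big_ord_widen n.+1
  (fun i => (-1) ^+ i * (w k * (q i * q (n - i - k)%N)))) ?leq_subr //.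
rewrite -big_split big1 // => i _ /=; rewrite addnK exprD -signr_odd.
rewrite -[(-1) ^+ k]signr_odd addnC subnDA subnAC.
case: (boolP (odd k)) => [|/w0->]; last by rewrite !mul0r !mulr0 addr0.
by rewrite expr1 mulrN1 mulNr addNr.
Qed.

(** The coefficient of z^k in z q'(z) / q(z). *)
Definition newton_weight (k : nat) : GammaQ :=
  if odd k then 2 *: psum rat k else 0.

Lemma qfun_newton_weight r :
  r%:R *: qfun r = \sum_(k < r.+1) newton_weight k * qfun (r - k).
Proof.
case: r => [|r]; first by rewrite scale0r big_ord1 [RHS]mul0r.
rewrite qfun_newton [RHS]big_ord_recl [X in X + _]mul0r [RHS]add0r.
rewrite [LHS]big_mkcond; apply: eq_bigr => i _.
rewrite lift0 subSS /newton_weight /=.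
by case: (odd i); [rewrite [RHS]mul0r|rewrite scalerAl].
Qed.

Lemma qfun_quadratic n : (0 < n)%N ->
  \sum_(i < n.+1) (-1) ^+ i * (qfun i * qfun (n - i)) = 0.
Proof.
apply: (newton_quadratic _ qfun_newton_weight) => k.
by rewrite /newton_weight => /negPf->.
Qed.

(** The terms i and 2m - i cancel in characteristic 2, leaving the middle one. *)
Lemma sum_symmetric2 (S : comNzRingType) (m : nat) (f : nat -> S) :
  2 = 0 :> S -> (forall i, (i <= m.*2)%N -> f (m.*2 - i)%N = f i) ->
  \sum_(i < m.*2.+1) f i = f m.
Proof.
move=> S2 f_sym; have m_lt : (m < m.*2.+1)%N by lia.
rewrite (bigD1 (Ordinal m_lt)) //= (bigID (fun i : 'I_ _ => (i < m)%N)) /=.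
rewrite [X in _ + (X + _)](reindex_inj rev_ord_inj) /=.
set a := \sum_(i < _ | _) _; set b := \sum_(i < _ | _) _.
suff -> : a = b by rewrite (addrr2 S2) addr0.
rewrite /a /b; apply: eq_big => i; rewrite -?val_eqE /= subSS => *.
  by have := ltn_ord i; lia.
by rewrite f_sym // -ltnS.
Qed.

Section HalfMod2.
Variables (A : comNzRingType) (R : comAlgType rat) (S : comNzRingType).
Variables (iota : {rmorphism A -> R}) (pi : {rmorphism A -> S}).
Hypothesis S2 : 2 = 0 :> S.
Variables (q p : nat -> R) (g : nat -> S).
Hypothesis q0 : q 0%N = 1.
Hypothesis q_newton : forall r, r.+1%:R *: q r.+1 =
  \sum_(i < r.+1 | ~~ odd i) 2 *: (p i.+1 * q (r - i)%N).
Hypothesis q_quadratic : forall n, (0 < n)%N ->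
  \sum_(i < n.+1) (-1) ^+ i * (q i * q (n - i)%N) = 0.
Hypothesis p_mod2 : forall n, odd n -> mod2 iota pi (p n) (g n).
Hypothesis g_double : forall n, g n.*2 = g n * g n.

(** Put P = q / 2. For odd r, Newton's recurrence reads r P_r = p_r plus an even combination. For
    even r, the quadratic relation expresses P_r by the products P_i P_(r-i), 0 < i < r; modulo 2
    only the middle one survives, and it is g(r/2)^2 = g(r). *)
Lemma half_mod2 r : (0 < r)%N -> mod2 iota pi ((2 : rat)^-1 *: q r) (g r).
Proof.
pose P r := (2 : rat)^-1 *: q r; rewrite -/(P r).
have qP n : q n = P n *+ 2.
  by rewrite -scaler_nat /P scalerA mulfV ?scale1r // pnatr_eq0.
have scale2K (x y : R) : x *+ 2 = y *+ 2 -> x = y.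
  move/(congr1 ( *:%R (2 : rat)^-1)); rewrite -!scaler_nat !scalerA mulVf ?pnatr_eq0 //.
  by rewrite !scale1r.
have [n] := ubnP r; elim: n r => // n IHn r; rewrite ltnS => rn r_gt0.
case: (boolP (odd r)) => [odd_r|even_r].
  case: r => // r in rn odd_r {r_gt0} *.
  apply: (@mod2_odd _ _ _ _ _ r.+1) => //.
  have -> : P r.+1 *+ r.+1 =
      p r.+1 + \sum_(i < r | ~~ odd i) (p i.+1 * P (r - i)%N) *+ 2.
    apply: scale2K; rewrite mulrnAC -qP -scaler_nat q_newton.
    have /= er := odd_r; rewrite big_mkcond big_ord_recr /= er subnn q0 mulr1 addrC.
    rewrite mulrnDl scaler_nat; congr (_ + _); rewrite -big_mkcond -sumrMnl.
    by apply: eq_bigr => i _; rewrite qP scaler_nat mulrnAr.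
  rewrite -[g _]addr0; apply: (mod2D S2); first exact: p_mod2.
  apply: (mod2_sum0 S2) => i ei; apply: (mod2_double S2 (y := g i.+1 * g (r - i)%N)).
  apply: mod2M; first by apply: p_mod2; rewrite /= ei.
  by apply: IHn; have := ltn_ord i; lia.
have [m r_m] : exists m, r = m.*2.+2.
  by exists r./2.-1; move: r_gt0; rewrite -[r]odd_double_half (negPf even_r); lia.
move: rn {even_r r_gt0}; rewrite {}r_m => rn.
(* The two end terms of the quadratic relation give 2 q_r since q_0 = 1; the whole relation is then
   divided by 4. *)
have -> : P m.*2.+2 =
    - (\sum_(i < m.*2.+1) (-1) ^+ i.+1 * (P i.+1 * P (m.*2.+1 - i)%N)).
  have : q m.*2.+2 + q m.*2.+2 +
      \sum_(i < m.*2.+1) (-1) ^+ i.+1 * (q i.+1 * q (m.*2.+1 - i)%N) = 0.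
    have := @q_quadratic m.*2.+2 isT; rewrite big_ord_recl big_ord_recr.
    rewrite !lift0 /= subn0 subnn q0 !mul1r mulr1 -signr_odd /= negbK odd_double.
    rewrite expr0 !mul1r addrA addrAC => e; apply: etrans e.
    by congr (_ + _ + _).
  under eq_bigr do rewrite !qP !(mulrnAl, mulrnAr).
  rewrite !sumrMnl qP -mulr2n -!mulrnDl => e4.
  apply: esym; apply: addr0_eq; rewrite addrC.
  by apply: (scale2K); apply: (scale2K); rewrite !mul0rn.
apply: (mod2N S2) => //.
have -> : g m.*2.+2 = \sum_(i < m.*2.+1) g i.+1 * g (m.*2.+1 - i)%N.
  rewrite (@sum_symmetric2 _ m (fun i => g i.+1 * g (m.*2.+1 - i)%N) S2).
    by rewrite -doubleS g_double -addnn -addSn addnK.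
  move=> i im /=.
  have -> : (m.*2.+1 - (m.*2 - i) = i.+1)%N by lia.
  by rewrite -subSn // mulrC.
apply: (mod2_sum S2) => i _; apply: (mod2_sign S2) => //.
by apply: mod2M; apply: IHn; have := ltn_ord i; lia.
Qed.

End HalfMod2.

(** * Leading terms of Q_lambda modulo 2 *)

Section LowerTerms.
Variables (S : comNzRingType) (h : {cmonom nat} -> S).
Hypothesis hM : forall m n, h (mmul m n) = h m * h n.
Hypothesis h1 : h mone = 1.

(** Error terms are filtered by their number of factors g(r), not by degree. Over F_2, closure under
    sums makes this a linear span. *)
Inductive lower (k : nat) : S -> Prop :=
| lower0 : lower k 0
| lowerD x y : lower k x -> lower k y -> lower k (x + y)
| lower_monom c : all (leq 1) c -> (size c < k)%N -> lower k (h (parts_monom c)).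

(** The first clause bounds the length of the leading monomial itself, so that its products with
    error terms are again error terms. *)
Definition leads (k : nat) (m : {cmonom nat}) (x : S) : Prop :=
  (exists c, [/\ all (leq 1) c, (size c <= k)%N & m = parts_monom c]) /\
  (exists2 z, lower k z & x = h m + z).

Lemma lower_leq k l x : (k <= l)%N -> lower k x -> lower l x.
Proof.
move=> kl; elim=> [|y z _ ly _ lz|c c1 ck]; first exact: lower0.
  exact: lowerD.
by apply: lower_monom; rewrite // (leq_trans ck).
Qed.

Lemma lower_mul_monom k c x : all (leq 1) c -> lower k x ->
  lower (k + size c) (x * h (parts_monom c)).
Proof.
move=> c1; elim=> [|y z _ ly _ lz|d d1 dk].
- by rewrite mul0r; apply: lower0.
- by rewrite mulrDl; apply: lowerD.
rewrite -hM -parts_monom_cat; apply: lower_monom.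
  by rewrite all_cat d1 c1.
by rewrite size_cat ltn_add2r.
Qed.

Lemma lowerM k l x y : lower k x -> lower l y -> lower (k + l) (x * y).
Proof.
move=> lx; elim=> [|y1 y2 _ l1 _ l2|c c1 cl].
- by rewrite mulr0; apply: lower0.
- by rewrite mulrDr; apply: lowerD.
apply: (@lower_leq (k + size c)); first by rewrite leq_add2l ltnW.
exact: lower_mul_monom.
Qed.

Lemma lower_sum k I (r : seq I) (P : pred I) (F : I -> S) :
  (forall i, P i -> lower k (F i)) -> lower k (\sum_(i <- r | P i) F i).
Proof.
move=> lF; elim/big_rec: _ => [|i x Pi lx]; first exact: lower0.
exact/lowerD/lx/lF.
Qed.

Lemma leads1 : leads 0 mone 1.
Proof.
split; first by exists [::]; rewrite /parts_monom big_nil.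
by exists 0; [exact: lower0|rewrite h1 addr0].
Qed.

Lemma leadsM k l m n x y : leads k m x -> leads l n y ->
  leads (k + l) (mmul m n) (x * y).
Proof.
move=> [[c [c1 ck ->]] [z lz ->]] [[d [d1 dl ->]] [w lw ->]]; split.
  exists (c ++ d); rewrite all_cat c1 d1 size_cat leq_add //.
  by split=> //; rewrite parts_monom_cat.
exists (h (parts_monom c) * w + (z * h (parts_monom d) + z * w)); last first.
  by rewrite hM mulrDl !mulrDr !addrA.
apply: lowerD; last apply: lowerD; last exact: lowerM.
  rewrite mulrC; apply: (@lower_leq (l + size c)); last exact: lower_mul_monom.
  by rewrite addnC leq_add2r.
apply: (@lower_leq (k + size d)); last exact: lower_mul_monom.
by rewrite leq_add2l.
Qed.

Lemma leads_prod I (r : seq I) (k : I -> nat) m (x : I -> S) :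
  (forall i, leads (k i) (m i) (x i)) ->
  leads (\sum_(i <- r) k i) (\big[mmul/mone]_(i <- r) m i) (\prod_(i <- r) x i).
Proof.
move=> L; elim: r => [|i r IHr]; first by rewrite !big_nil; apply: leads1.
by rewrite !big_cons; apply: leadsM.
Qed.

(** In characteristic 2 an odd number of copies of the leading monomial add up to a single one. *)
Lemma leads_sum_odd k m (I : finType) (D : {set I}) (x : I -> S) :
  2 = 0 :> S -> odd #|D| -> (forall i, leads k m (x i)) ->
  exists2 z, lower k z & \sum_(i in D) x i = h m + z.
Proof.
move=> S2 oD L; exists (\sum_(i in D) (x i - h m)).
  by apply: lower_sum => i _; have [_ [z lz ->]] := L i; rewrite addrC addKr.
by rewrite sumrB sumr_const (mulrn_odd2 S2) // addrC subrK.
Qed.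

(* Matrix entries of the Pfaffian modulo 2, up to normalisation. *)
Definition pair_residue (r s : nat) : S :=
  h (part_monom r) * h (part_monom s) +
  (if (0 < r)%N && (0 < s)%N then h (part_monom (r + s)) else 0).

Lemma pair_residueC r s : pair_residue r s = pair_residue s r.
Proof. by rewrite /pair_residue mulrC andbC addnC. Qed.

Lemma leads_pair_residue r s :
  leads ((0 < r) + (0 < s))%N (mmul (part_monom r) (part_monom s))
    (pair_residue r s).
Proof.
have one n : parts_monom [:: n] = part_monom n.
  by rewrite /parts_monom big_cons big_nil mulm1.
split.
  exists ([seq x <- [:: r] | (0 < x)%N] ++ [seq x <- [:: s] | (0 < x)%N]).
  rewrite all_cat !filter_all size_cat !size_filter /= !addn0; split=> //.
  rewrite parts_monom_cat; congr mmul.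
    by case: r => [|r] /=; rewrite ?one ?/parts_monom ?big_nil.
  by case: s => [|s] /=; rewrite ?one ?/parts_monom ?big_nil.
rewrite /pair_residue hM; eexists; last reflexivity.
case: r => [|r]; first exact: lower0.
case: s => [|s]; first exact: lower0.
by rewrite -one; apply: lower_monom.
Qed.

End LowerTerms.

(** * Residues of the Pfaffian entries and of Q_lambda *)

Section QpairMod2.
Variables (A : comNzRingType) (R : comAlgType rat) (S : comNzRingType).
Variables (iota : {rmorphism A -> R}) (pi : {rmorphism A -> S}).
Hypothesis S2 : 2 = 0 :> S.
Variables (h : {cmonom nat} -> S) (q : nat -> R).
Hypothesis h1 : h mone = 1.
Hypothesis q0 : q 0%N = 1.
Hypothesis q_mod2 : forall r, (0 < r)%N ->
  mod2 iota pi ((2 : rat)^-1 *: q r) (h (part_monom r)).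

(** The power of 2 removed from q_r; q_0 = 1, which belongs to an appended zero part, needs none. *)
Definition qnorm (r : nat) : rat := if r is 0 then 1 else 2.

(** After division by 4 the terms with k < s keep a factor 2 and vanish. The term k = s contains q_0
    = 1 instead of a second even factor, and leaves g(r+s). *)
Lemma pair_mod2 r s : (0 < r)%N ->
  mod2 iota pi ((qnorm r * qnorm s)^-1 *: (q r * q s +
     2%:R * \sum_(1 <= k < s.+1) (-1) ^+ k * (q (r + k)%N * q (s - k)%N)))
   (pair_residue h r s).
Proof.
move=> r_gt0; pose P r := (2 : rat)^-1 *: q r.
have qP n : q n = P n *+ 2.
  by rewrite -scaler_nat /P scalerA mulfV ?scale1r // pnatr_eq0.
have -> : qnorm r = 2 by case: r r_gt0.
rewrite /pair_residue r_gt0; case: s => [|s] /=.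
  rewrite big_geq // mulr0 addr0 q0 mulr1 h1 mulr1 addr0 mulr1; exact: q_mod2.
have -> : (2 * 2 : rat)^-1 *: (q r * q s.+1 +
     2%:R * \sum_(1 <= k < s.+2) (-1) ^+ k * (q (r + k)%N * q (s.+1 - k)%N)) =
   P r * P s.+1 + (\sum_(1 <= k < s.+1)
     (-1) ^+ k * (P (r + k)%N * P (s.+1 - k)%N) *+ 2 +
     (-1) ^+ s.+1 * P (r + s.+1)%N).
  have e4 (x : R) : (2 * 2 : rat) *: x = x *+ 2 *+ 2.
    by rewrite -scalerA !scaler_nat.
  apply: (can_inj (scalerK (_ : (2 * 2 : rat) != 0))) => //.
  rewrite scalerA mulfV // scale1r e4 big_nat_recr //= subnn q0 mulr1.
  under eq_bigr do rewrite !qP !(mulrnAl, mulrnAr).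
  by rewrite !qP !(mulrnAl, mulrnAr) !sumrMnl mul1r; ring.
apply: (mod2D S2); first by apply: mod2M; apply: q_mod2.
rewrite -[h _]add0r; apply: (mod2D S2); last first.
  by apply: (mod2_sign S2); apply: q_mod2; rewrite addnS.
rewrite big_nat; apply: (mod2_sum0 S2) => k /andP[k1 ks].
apply: (mod2_double S2 (y := h (part_monom (r + k)) * h (part_monom (s.+1 - k)))).
apply: (mod2_sign S2); apply: mod2M; apply: q_mod2; first by rewrite addn_gt0 r_gt0.
by rewrite subn_gt0.
Qed.

End QpairMod2.

Lemma malg_monomM (K : comNzRingType) (m n : {cmonom nat}) :
  << mmul m n >> = << m >> * << n >> :> Gamma K.
Proof. by rewrite malgM_def fgmulUU mulr1. Qed.

Lemma qfun_mod2 r : (0 < r)%N ->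
  Gamma_mod2 ((2 : rat)^-1 *: qfun r) << part_monom r >>.
Proof.
apply: (half_mod2 (g := fun r => << part_monom r >>) GammaF2_2 qfun0
  qfun_newton qfun_quadratic) => n.
  move=> odd_n; have n_gt0 : (0 < n)%N by case: n odd_n.
  have -> : part_monom n = ucm n./2; last exact: Gamma_mod2_monom.
  apply/eqP/cmP => i; rewrite part_monomE // cmU.
  rewrite part_pnat_id -?odd_2'nat // lognE /= dvdn2 odd_n /= andbF muln1.
  by rewrite -[in LHS](odd_double_half n) odd_n add1n eqSS -!muln2 eqn_pmul2r.
by rewrite part_monom_double malg_monomM.
Qed.

Lemma Qpair_mod2 r s : (0 < r)%N ->
  Gamma_mod2 ((qnorm r * qnorm s)^-1 *: Qpair r s)
    (pair_residue (fun m => << m >> : Gamma 'F_2) r s).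
Proof. exact: (pair_mod2 GammaF2_2 _ qfun0 qfun_mod2). Qed.

(** The pairs {s(2i), s(2i+1)} exhaust the indices, so a product over all rows can be grouped along
    any matching. *)
Lemma big_pairs (T : Type) (idx : T) (op : Monoid.com_law idx) m
    (s : 'S_(m.*2)) (F : 'I_(m.*2) -> T) :
  \big[op/idx]_k F k =
  \big[op/idx]_(i < m) op (F (s (pair_fst i))) (F (s (pair_snd i))).
Proof.
rewrite (reindex_inj (@perm_inj _ s)) /=.
rewrite (reindex (fun x : bool * 'I_m => pair_elt x.2 x.1)) /=; last first.
  exists (fun k : 'I_(m.*2) => (odd k, pair_index k)) => [[b i] _|k _] /=.
    by rewrite odd_pair_elt pair_eltK.
  exact: pair_elt_index.
rewrite -(pair_big xpredT xpredT (fun b i => F (s (pair_elt i b)))) /=.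
by rewrite big_bool big_split Monoid.mulmC.
Qed.

(** An appended zero part, read through the default of [nth], contributes the neutral element. *)
Lemma big_nth_widen (T : Type) (idx : T) (op : Monoid.law idx) (l : seq nat) K
    (F : nat -> T) : (size l <= K)%N -> F 0%N = idx ->
  \big[op/idx]_(k < K) F (nth 0%N l k) = \big[op/idx]_(r <- l) F r.
Proof.
move=> lK F0; rewrite (big_nth 0%N) big_mkord.
rewrite [RHS](big_ord_widen K (fun k => F (nth 0%N l k))) // [RHS]big_mkcond.
apply: eq_bigr => k _; case: ltnP => // lk.
by rewrite nth_default.
Qed.

Lemma Qmatrix_antisym l i j : Qmatrix l i j = - Qmatrix l j i.
Proof.
by rewrite !mxE; case: (ltngtP i j) => _; rewrite ?opprK ?oppr0.
Qed.

Lemma double_uphalf n : ((uphalf n).*2 = n + odd n)%N.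
Proof. by rewrite uphalf_half -[in RHS](odd_double_half n); lia. Qed.

Section SchurQMod2.
Variables (l : seq nat).
Hypothesis l_gt0 : all (leq 1) l.

Let m := uphalf (size l).
Let a (k : 'I_(m.*2)) := nth 0%N l k.
Let h (u : {cmonom nat}) : Gamma 'F_2 := << u >>.

Lemma Qmatrix_mod2 i j : i != j ->
  Gamma_mod2 ((qnorm (a i) * qnorm (a j))^-1 *: Qmatrix l i j)
    (pair_residue h (a i) (a j)).
Proof.
(* Only the last row can carry the appended zero, so the smaller index of a pair has a positive
   part. *)
have a_gt0 (i' j' : 'I_(m.*2)) : (i' < j')%N -> (0 < a i')%N.
  move=> ij; apply: (allP l_gt0); rewrite mem_nth //.
  apply: (leq_trans ij); rewrite -ltnS (leq_trans (ltn_ord j')) //.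
  by rewrite double_uphalf -addn1 leq_add2l leq_b1.
move=> ij; rewrite mxE; case: (ltngtP i j) => [lt_ij|lt_ji|eq_ij].
- exact/Qpair_mod2/a_gt0/lt_ij.
- rewrite scalerN; apply: (mod2N GammaF2_2).
  by rewrite mulrC pair_residueC; apply/Qpair_mod2/a_gt0/lt_ji.
by rewrite (val_inj eq_ij) eqxx in ij.
Qed.

Let c := \prod_k (qnorm (a k))^-1.

(** The scalar [c] normalises every matching at once, as each matching uses each row exactly once.
    Every matching then has leading term g(l), and their number is odd. *)
Lemma schurQ_mod2 : exists2 c : rat, c != 0 &
  exists2 z, lower h (size l) z &
    Gamma_mod2 (c *: schurQ l) (h (parts_monom l) + z).
Proof.
exists c.
  by apply/prodf_neq0 => k _; rewrite invr_eq0; case: (a k).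
pose x (D : {set 'S_(m.*2)}) := \prod_(i < m)
  pair_residue h (a (repr D (pair_fst i))) (a (repr D (pair_snd i))).
have L (D : {set 'S_(m.*2)}) : leads h (size l) (parts_monom l) (x D).
  have -> : size l = \sum_(i < m) ((0 < a (repr D (pair_fst i))) +
      (0 < a (repr D (pair_snd i))))%N.
    rewrite -(big_pairs _ (repr D) (fun k => (0 < a k) : nat)).
    rewrite (big_nth_widen _ (F := fun r => (0 < r) : nat)) //; last first.
      by rewrite /m double_uphalf leq_addr.
    by rewrite -sum1_size; apply: eq_big_seq => r /(allP l_gt0) ->.
  have -> : parts_monom l = \big[mmul/mone]_(i < m)
      mmul (part_monom (a (repr D (pair_fst i)))) (part_monom (a (repr D (pair_snd i)))).
    rewrite -(big_pairs _ (repr D) (fun k => part_monom (a k))).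
    rewrite (big_nth_widen _ (F := part_monom)) //.
    by rewrite /m double_uphalf leq_addr.
  apply: leads_prod => [u v||i]; [exact: malg_monomM|by []|].
  by apply: leads_pair_residue => u v; apply: malg_monomM.
have [z lz e] := leads_sum_odd GammaF2_2 (odd_hyper_index m) L.
exists z => //; rewrite -e /schurQ (pfaffian_cosets (@Qmatrix_antisym l)).
rewrite scaler_sumr; apply: (mod2_sum GammaF2_2) => D _.
rewrite /pfaffian_term scalerAr; apply: (mod2_sign GammaF2_2).
rewrite /c (big_pairs _ (repr D) (fun k => (qnorm (a k))^-1)) -scaler_prod.
apply: mod2_prod => i _; rewrite /= -invfM; apply: Qmatrix_mod2.
by rewrite (inj_eq perm_inj); apply: (pair_elt_neq i i false).
Qed.

End SchurQMod2.

(** * Invertibility of the coefficient matrix *)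

Lemma lower_coeff k z d :
  lower (fun m => << m >> : Gamma 'F_2) k z ->
  all (leq 1) d -> uniq d -> (k <= size d)%N -> z@_(parts_monom d) = 0.
Proof.
move=> lz d1 ud kd; elim: lz => [|x y _ ex _ ey|c c1 ck].
- exact: mcoeff0.
- by rewrite mcoeffD ex ey addr0.
rewrite mcoeffU1; case: eqP => // e.
by have := parts_monom_size c1 d1 ud e; rewrite leqNgt (leq_trans ck).
Qed.

Section Independence.
Variable N : nat.
Implicit Types l mu : SP N.

Lemma SP_pos l : all (leq 1) l.
Proof. by have /and3P[] := valP l. Qed.

Lemma SP_uniq l : uniq l.
Proof. exact: strict_partition_uniq (valP l). Qed.

Lemma SP_monom_inj l mu : (parts_monom l == parts_monom mu) = (l == mu).
Proof.
apply/eqP/eqP => [e|->//]; apply: val_inj.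
exact: strict_parts_monom_inj (valP l) (valP mu) e.
Qed.

Let sp (i : 'I_#|{: SP N}|) : SP N := enum_val i.

Let Q_mx := \matrix_(i, j < #|{: SP N}|)
  (schurQ (sp i))@_(parts_monom (sp j)).

Lemma schurQ_det : \det Q_mx != 0.
Proof.
have /fin_all_exists[cz cz_prop] i : exists cz : rat * Gamma 'F_2,
    lower (fun m => << m >>) (size (sp i)) cz.2 /\
    Gamma_mod2 (cz.1 *: schurQ (sp i)) (<< parts_monom (sp i) >> + cz.2).
  by have [c _ [z lz Qz]] := schurQ_mod2 (SP_pos (sp i)); exists (c, z).
pose b := \matrix_(i, j < #|{: SP N}|)
  (<< parts_monom (sp i) >> + (cz i).2)@_(parts_monom (sp j)).
have b0 i j : (size (sp i) <= size (sp j))%N -> b i j = (i == j)%:R.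
  move=> ij; have [lz _] := cz_prop i.
  rewrite mxE mcoeffD (lower_coeff lz) ?SP_pos ?SP_uniq // addr0 mcoeffU1.
  by rewrite SP_monom_inj (inj_eq enum_val_inj).
have det_b : \det b != 0.
  apply/det0P => -[v v_neq0 vb].
  have [i1 vi1] : exists i, v 0 i != 0.
    apply/existsP; apply: contraNT v_neq0 => /existsPn v0; apply/eqP/rowP => i.
    by rewrite mxE; apply/eqP; have := v0 i; rewrite negbK.
  (* For a kernel vector [v], let [i] be a longest index in its support: every other [k] in the
     support has [b k i] = 0, so the i-th entry of [v *m b] is [v 0 i], a contradiction. *)
  case: (@arg_maxnP _ i1 (fun i => v 0 i != 0) (fun i => size (sp i)) vi1) => i vi i_max.
  have /rowP/(_ i) := vb; rewrite !mxE (bigD1 i) //= big1 => [|k ki].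
    by rewrite addr0 b0 // eqxx mulr1 => /eqP; rewrite (negPf vi).
  have [->|vk] := eqVneq (v 0 k) 0; first by rewrite mul0r.
  by rewrite b0; [rewrite (negPf ki) mulr0|apply: i_max].
pose B := diag_mx (\row_i (cz i).1) *m Q_mx.
have : \det B != 0.
  apply: rat_mod2_neq0 det_b; apply: mod2_det => [|i j]; first exact/val_inj.
  have [_ Qz] := cz_prop i; have := Gamma_mod2_coeff (parts_monom (sp j)) Qz.
  by rewrite mcoeffZ /B mul_diag_mx !mxE.
by rewrite det_mulmx mulf_eq0 => /norP[].
Qed.

Lemma schurQ_coeff_inv : exists Q_inv : SP N -> SP N -> rat, forall l mu,
  \sum_(nu : SP N) (schurQ l)@_(parts_monom nu) * Q_inv nu mu = (l == mu)%:R.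
Proof.
exists (fun nu mu => invmx Q_mx (enum_rank nu) (enum_rank mu)) => l mu.
have : (Q_mx *m invmx Q_mx) (enum_rank l) (enum_rank mu) = (l == mu)%:R.
  by rewrite mulmxV ?unitmxE ?unitfE ?schurQ_det // mxE (inj_eq enum_rank_inj).
rewrite mxE => <-; rewrite [RHS](reindex enum_rank) /=.
  by apply: eq_bigr => nu _; rewrite mxE /sp !enum_rankK.
by exists enum_val => i _; rewrite ?enum_rankK ?enum_valK.
Qed.

End Independence.

(** * Specialization and palindromicity *)

Definition monom_eval (K : comNzRingType) (v : nat -> K) (m : {cmonom nat}) : K :=
  \prod_(i <- finsupp m) v i ^+ m i.

Section MonomEval.
Variables (K : comNzRingType) (v : nat -> K).

Lemma monom_evalEw (m : {cmonom nat}) (d : {fset nat}) : (finsupp m `<=` d)%fset ->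
  monom_eval v m = \prod_(i <- d) v i ^+ m i.
Proof.
move=> md; rewrite /monom_eval; apply: big_fset_incl => // i _.
by rewrite -cmE_eq0 => /eqP ->.
Qed.

Lemma monom_evalM m n :
  monom_eval v (mmul m n) = monom_eval v m * monom_eval v n.
Proof.
rewrite (@monom_evalEw m (finsupp m `|` finsupp n)%fset) ?fsubsetUl //.
rewrite (@monom_evalEw n (finsupp m `|` finsupp n)%fset) ?fsubsetUr //.
rewrite (@monom_evalEw (mmul m n) (finsupp m `|` finsupp n)%fset) ?mdomD //.
by rewrite -big_split; apply: eq_bigr => i _; rewrite cmM exprD.
Qed.

Lemma monom_eval1 : monom_eval v mone = 1.
Proof. by rewrite /monom_eval mdom1 big_seq_fset0. Qed.

Lemma monom_evalU i : monom_eval v (ucm i) = v i.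
Proof. by rewrite /monom_eval mdomU big_seq_fset1 cmUU. Qed.

Lemma monom_eval_part r : (0 < r)%N ->
  monom_eval v (part_monom r) = v (r`_2^')%N./2 ^+ (2 ^ logn 2 r).
Proof.
case: r => // r _; rewrite /part_monom.
elim: (2 ^ _)%N => [|n IHn]; first by rewrite monom_eval1.
by rewrite iterS monom_evalM monom_evalU IHn exprS.
Qed.

Lemma monom_eval_parts c :
  monom_eval v (parts_monom c) = \prod_(r <- c) monom_eval v (part_monom r).
Proof. by apply: big_morph; [exact: monom_evalM|exact: monom_eval1]. Qed.

End MonomEval.

Lemma monomE (m : {cmonom nat}) :
  m = \big[mmul/mone]_(i <- finsupp m) iter (m i) (mmul (ucm i)) mone.
Proof.
apply/eqP/cmP => j.
rewrite (big_morph (fun u : {cmonom nat} => u j) (fun u v => cmM j u v) (cm1 j)).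
have E i : iter (m i) (mmul (ucm i)) mone j = ((i == j) * m i)%N.
  elim: (m i) => [|n IHn]; first by rewrite /= cm1 muln0.
  by rewrite iterS cmM cmU IHn mulnS.
rewrite (eq_bigr _ (fun i _ => E i)).
case: (boolP (j \in finsupp m)) => [jm|jm].
  rewrite (big_fsetD1 j) //= eqxx mul1n [X in (_ + X)%N]big_seq big1 ?addn0 //.
  by move=> i; rewrite in_fsetD1 => /andP[/negPf-> _].
rewrite big_seq big1; last by move=> i; case: eqVneq jm => [->/negPf->|].
by apply/eqP; rewrite cmE_eq0.
Qed.

Lemma monom_prod (K : comNzRingType) (m : {cmonom nat}) :
  \prod_(i <- finsupp m) (<< ucm i >> : Gamma K) ^+ m i = << m >>.
Proof.
pose hM := @malg_monomM K.
rewrite [in RHS](monomE m) (big_morph (fun u => << u >> : Gamma K) hM (mpolyC1E _ K)).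
apply: eq_bigr => i _; elim: (m i) => [|n IHn]; last by rewrite iterS hM exprS IHn.
by rewrite expr0 -(mpolyC1E _ K).
Qed.

(** Rescaling the p_n is diagonal on monomials, with eigenvalue [monom_eval]. *)
Lemma mcoeff_Gamma_subst (K : comNzRingType) (c : nat -> K) (g : Gamma K) m :
  (Gamma_subst (fun n => c n *: psum K n) g)@_m =
  g@_m * monom_eval (fun i => c i.*2.+1) m.
Proof.
apply: (mcoeff_msupp_sum
  (w := fun k => g@_k * monom_eval (fun i => c i.*2.+1) k)) => [k|mg]; last first.
  by rewrite (mcoeff_outdom mg) mul0r.
rewrite mul_malgC mcoeffZ -mulrnAr; congr (_ * _).
rewrite (eq_bigr (fun i => c i.*2.+1 ^+ k i *: << ucm i >> ^+ k i)); last first.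
  by move=> i _; rewrite exprZn /psum /= uphalf_double.
by rewrite scaler_prod monom_prod mcoeffZ mcoeffU1 mulr_natr.
Qed.

Fact rat_Qts_is_zmod_morphism : zmod_morphism rat_Qts.
Proof. by move=> x y; rewrite /rat_Qts !polyCB tofracB. Qed.

Fact rat_Qts_is_monoid_morphism : monoid_morphism rat_Qts.
Proof. by split=> [|x y]; rewrite /rat_Qts ?polyC1 ?tofrac1 // !polyCM tofracM. Qed.

HB.instance Definition _ :=
  GRing.isZmodMorphism.Build rat Qts rat_Qts rat_Qts_is_zmod_morphism.
HB.instance Definition _ :=
  GRing.isMonoidMorphism.Build rat Qts rat_Qts rat_Qts_is_monoid_morphism.

Section Specialization.
Variable M : nat.

Let nz (p : {poly {poly rat}}) : p.['X^M] != 0 -> p%:F != 0 :> Qts.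
Proof. by rewrite tofrac_eq0; apply: contraNneq => ->; rewrite horner0. Qed.

Lemma specializes_const c : specializes M (rat_Qts c) (c%:P)%:F.
Proof.
by exists c%:P%:P, 1; rewrite hornerC oner_neq0 !hornerC tofrac1 !divr1.
Qed.

Lemma specializesD f g f' g' : specializes M f g -> specializes M f' g' ->
  specializes M (f + f') (g + g').
Proof.
move=> [a [b [b0 -> ->]]] [c [d [d0 -> ->]]]; exists (a * d + c * b), (b * d).
rewrite hornerM mulf_neq0 // hornerD !hornerM.
by rewrite !tofracD !tofracM !addf_div // ?nz // tofrac_eq0.
Qed.

Lemma specializesM f g f' g' : specializes M f g -> specializes M f' g' ->
  specializes M (f * f') (g * g').
Proof.
move=> [a [b [b0 -> ->]]] [c [d [d0 -> ->]]]; exists (a * c), (b * d).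
by rewrite !hornerM mulf_neq0 // !tofracM !mulf_div.
Qed.

Lemma specializes_sum I (r : seq I) F G :
  (forall i, specializes M (F i) (G i)%:F) ->
  specializes M (\sum_(i <- r) F i) (\sum_(i <- r) G i)%:F.
Proof.
move=> FG; elim: r => [|i r IHr].
  by rewrite !big_nil; have := specializes_const 0; rewrite rmorph0 polyC0.
by rewrite !big_cons tofracD; apply: specializesD.
Qed.

Lemma specializes_prod I (r : seq I) F G :
  (forall i, specializes M (F i) (G i)%:F) ->
  specializes M (\prod_(i <- r) F i) (\prod_(i <- r) G i)%:F.
Proof.
move=> FG; elim: r => [|i r IHr].
  by rewrite !big_nil; have := specializes_const 1; rewrite rmorph1 polyC1.
by rewrite !big_cons tofracM; apply: specializesM.
Qed.

Lemma specializesX f p n : specializes M f p%:F ->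
  specializes M (f ^+ n) (p ^+ n)%:F.
Proof.
move=> fp; rewrite -(card_ord n) -!prodr_const -!big_enum.
exact: specializes_prod.
Qed.

Definition geometric (n : nat) : {poly rat} := \sum_(j < M) 'X^(n * j).

Lemma specializes_geometric n : (0 < n)%N ->
  specializes M ((1 - var_t ^+ n) / (1 - var_s ^+ n)) (geometric n)%:F.
Proof.
(* The denominator 1 - s^n is constant in the outer variable, so evaluation at ['X^M] leaves 1 -
   t^n, nonzero because n > 0. *)
move=> n0; exists (1 - 'X^n), (1 - 'X^n)%:P.
have nz1 : 1 - 'X^n != 0 :> {poly rat}.
  apply/eqP => /(congr1 (horner^~ 0)) /eqP.
  by rewrite !hornerE expr0n eqn0Ngt n0 subr0 oner_eq0.
rewrite hornerC nz1; split=> //.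
  by rewrite polyCB polyC1 !tofracB tofrac1 polyC_exp !tofracXn.
rewrite !hornerE -exprM mulnC exprM.
have -> : 1 - 'X^n ^+ M = geometric n * (1 - 'X^n) :> {poly rat}.
  rewrite mulrC -[RHS]opprK -mulNr opprB.
  rewrite /geometric; under eq_bigr do rewrite exprM.
  by rewrite -subrX1 opprB.
by rewrite tofracM mulfK // tofrac_eq0.
Qed.

End Specialization.

Section Palindromes.
Implicit Types f g : {poly rat}.

Let phi : {rmorphism rat -> Qt} := @FracField.tofrac {poly rat} \o polyC.

Let eval_invE f : eval_inv f = (map_poly phi f).[('X : {poly rat})%:F^-1].
Proof. by []. Qed.

Lemma eval_invD f g : eval_inv (f + g) = eval_inv f + eval_inv g.
Proof. by rewrite !eval_invE rmorphD hornerD. Qed.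

Lemma eval_invM f g : eval_inv (f * g) = eval_inv f * eval_inv g.
Proof. by rewrite !eval_invE rmorphM hornerM. Qed.

Lemma eval_invC c : eval_inv c%:P = (c%:P)%:F.
Proof. by rewrite eval_invE map_polyC hornerC. Qed.

Lemma eval_invXn n : eval_inv 'X^n = ('X : {poly rat})%:F ^- n.
Proof. by rewrite eval_invE map_polyXn hornerXn exprVn. Qed.

Lemma X_neq0 : ('X : {poly rat})%:F != 0.
Proof. by rewrite tofrac_eq0 polyX_eq0. Qed.

Lemma palindromicM d e f g : palindromic d f -> palindromic e g ->
  palindromic (d + e) (f * g).
Proof.
by rewrite /palindromic => pf pg; rewrite tofracM eval_invM exprD pf pg mulrACA.
Qed.

Lemma palindromicC c : palindromic 0 c%:P.
Proof. by rewrite /palindromic mul1r eval_invC. Qed.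

Lemma palindromic_sum d I (r : seq I) (F : I -> {poly rat}) :
  (forall i, palindromic d (F i)) -> palindromic d (\sum_(i <- r) F i).
Proof.
move=> pF; elim: r => [|i r IHr].
  by rewrite big_nil /palindromic -polyC0 eval_invC tofrac0 mulr0.
by rewrite big_cons /palindromic tofracD eval_invD mulrDr -pF -IHr.
Qed.

Lemma palindromicX d n f : palindromic d f -> palindromic (d * n) (f ^+ n).
Proof.
move=> pf; elim: n => [|n IHn]; first by rewrite muln0; apply: palindromicC.
by rewrite exprS mulnS; apply: palindromicM.
Qed.

Lemma palindromic_geometric M n : palindromic ((M - 1) * n) (geometric M n).
Proof.
rewrite /palindromic /geometric.
have ev I (r : seq I) F : eval_inv (\sum_(i <- r) F i) = \sum_(i <- r) eval_inv (F i).
  by apply: big_morph => [x y|]; rewrite ?eval_invD // -polyC0 eval_invC tofrac0.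
rewrite ev rmorph_sum mulr_sumr (reindex_inj rev_ord_inj) /=.
apply: eq_bigr => i _; rewrite eval_invXn tofracXn.
(* After the reversal j -> M-1-j the two sums agree term by term through this splitting of the
   exponent. *)
have -> : ((M - 1) * n = n * (M - i.+1) + n * i)%N.
  by have := ltn_ord i; case: M i => [|M'] i //; nia.
by rewrite exprD mulfK // expf_neq0 // X_neq0.
Qed.

Lemma palindromic_coef d f : palindromic d f -> f`_d = f.[0].
Proof.
(* Multiplying by X^k clears the negative powers; the successor keeps the index 0 available even for
   f = 0. In degree d + k only i = 0 contributes. *)
set k := (size f).+1; rewrite /palindromic eval_invE.
rewrite (@horner_coef_wide _ k); last by rewrite size_map_poly leqnSn.
move=> /(congr1 (fun x => ('X%:F : Qt) ^+ k * x)).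
have -> : ('X%:F : Qt) ^+ k * (('X%:F : Qt) ^+ d *
     \sum_(i < k) (map_poly phi f)`_i * ('X%:F : Qt)^-1 ^+ i) =
   (\sum_(i < k) (f`_i)%:P * 'X^(d + (k - i)))%:F.
  rewrite mulrA -exprD mulr_sumr rmorph_sum; apply: eq_bigr => i _.
  rewrite coef_map /= tofracM tofracXn mulrCA; congr (_ * _).
  have -> : (k + d = d + (k - i) + i)%N by have := ltn_ord i; lia.
  by rewrite exprVn exprD mulfK // expf_neq0 // X_neq0.
rewrite -tofracXn -tofracM => /eqP; rewrite tofrac_eq => /eqP.
move/(congr1 (fun p : {poly rat} => p`_(d + k))).
rewrite coefXnM ltnNge leq_addl /= addnK => ->.
rewrite coef_sum (bigD1 ord0) //= coefCM coefXn subn0 eqxx mulr1 horner_coef0.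
rewrite big1 ?addr0 // => i i0; rewrite coefCM coefXn; case: eqP; rewrite ?mulr0 //.
move/eqP; rewrite eqn_add2l => /eqP e.
have : (k - i < k)%N by rewrite ltn_subrL lt0n i0.
by rewrite -e ltnn.
Qed.

End Palindromes.

(** * The transition matrix as a conjugate of a diagonal matrix *)

Lemma diagonal_conjugation (I : finType) (F K : comNzRingType)
    (f : {rmorphism F -> K}) (C : I -> I -> K) (A B : I -> I -> F) (D : I -> K) :
  (forall i j, \sum_k A i k * B k j = (i == j)%:R) ->
  (forall i j, f (A i j) * D j = \sum_k C i k * f (A k j)) ->
  forall i j, C i j = \sum_k f (A i k * B k j) * D k.
Proof.
move=> AB CA i j.
(* A D is replaced by C A inside A D B, after which A B = 1 leaves C. *)
rewrite (eq_bigr (fun k => \sum_l C i l * f (A l k * B k j))); last first.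
  move=> k _; rewrite rmorphM mulrAC CA mulr_suml.
  by apply: eq_bigr => l _; rewrite rmorphM mulrA.
rewrite exchange_big (bigD1 j) //= -mulr_sumr -rmorph_sum AB eqxx rmorph1 mulr1.
rewrite big1 ?addr0 // => k /negPf kj.
by rewrite -mulr_sumr -rmorph_sum AB kj rmorph0 mulr0.
Qed.

Lemma transition_formula N (C : SP N -> SP N -> Qts) (Q_inv : SP N -> SP N -> rat)
    (l mu : SP N) : is_transition C ->
  (forall l mu : SP N,
    \sum_(nu : SP N) (schurQ l)@_(parts_monom nu) * Q_inv nu mu = (l == mu)%:R) ->
  C l mu = \sum_(nu : SP N)
    rat_Qts ((schurQ l)@_(parts_monom nu) * Q_inv nu mu) *
    monom_eval (fun i => (1 - var_t ^+ i.*2.+1) / (1 - var_s ^+ i.*2.+1))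
      (parts_monom nu).
Proof.
move=> C_def QK; apply: (diagonal_conjugation (f := rat_Qts) QK) => {}l nu.
have /(congr1 (fun g => g@_(parts_monom nu))) := C_def l.
rewrite mcoeff_Gamma_subst mcoeff_Gamma_extend ?rmorph0 // => ->.
rewrite [LHS]raddf_sum /=; apply: eq_bigr => k _.
by rewrite mcoeffZ mcoeff_Gamma_extend ?rmorph0.
Qed.

(** A part r = 2^a b contributes the 2^a-th power of a factor of darga (M-1)b, hence darga
    (M-1)r. *)
Lemma palindromic_parts M c : all (leq 1) c ->
  palindromic ((M - 1) * sumn c)
    (monom_eval (fun i => geometric M i.*2.+1) (parts_monom c)).
Proof.
rewrite monom_eval_parts; elim: c => [_|r c IHc /andP[r_gt0 /IHc pc]].
  by rewrite big_nil muln0; apply: palindromicC.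
rewrite big_cons /= mulnDr; apply: palindromicM => //.
rewrite monom_eval_part //; set e := logn 2 r.
have od : ((r`_2^')./2.*2.+1 = r`_2^')%N.
  by rewrite -[RHS]odd_double_half odd_2'nat part_pnat.
have -> : ((M - 1) * r = (M - 1) * (r`_2^')./2.*2.+1 * 2 ^ e)%N.
  by rewrite od -mulnA [(_ * 2 ^ e)%N]mulnC -p_part partnC.
exact/palindromicX/palindromic_geometric.
Qed.

Lemma monom_eval_geometric0 M m : (0 < M)%N ->
  (monom_eval (fun i => geometric M i.*2.+1) m).[0] = 1.
Proof.
move=> M_gt0; rewrite horner_prod big1 // => i _; rewrite horner_exp.
rewrite /geometric horner_sum (bigD1 (Ordinal M_gt0)) //= big1 => [|j].
  by rewrite muln0 expr0 hornerC addr0 expr1n.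
by rewrite -val_eqE /= => j0; rewrite hornerXn expr0n muln_eq0 (negPf j0).
Qed.

Theorem theorem4p3 (M N : nat) (M_gt0 : (0 < M)%N)
    (C : SP N -> SP N -> Qts) (C_def : is_transition C) (lambda mu : SP N) :
  exists CM : {poly rat},
    [/\ specializes M (C lambda mu) CM%:F,
        CM%:F = ('X : {poly rat})%:F ^+ ((M - 1) * N) * eval_inv CM,
        palindromic ((M - 1) * N) CM,
        CM.[0] = (lambda == mu)%:R
      & CM`_((M - 1) * N) = (lambda == mu)%:R].
Proof.
have [Q_inv QK] := schurQ_coeff_inv N.
pose E (nu : SP N) := monom_eval (fun i => geometric M i.*2.+1) (parts_monom nu).
(* The specialised entry of A D A^-1. *)
pose CM := \sum_(nu : SP N)
  ((schurQ lambda)@_(parts_monom nu) * Q_inv nu mu)%:P * E nu.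
have CM_pal : palindromic ((M - 1) * N) CM.
  apply: palindromic_sum => nu; rewrite -[X in palindromic X]add0n.
  apply: palindromicM; first exact: palindromicC.
  have /and3P[_ nu_gt0 /eqP nu_N] := valP nu.
  by have := palindromic_parts M nu_gt0; rewrite nu_N.
have CM0 : CM.[0] = (lambda == mu)%:R.
  (* At t = 0 the diagonal matrix is the identity, so A A^-1 remains. *)
  rewrite /CM horner_sum -QK; apply: eq_bigr => nu _.
  by rewrite hornerM hornerC monom_eval_geometric0 // mulr1.
exists CM; split=> //; last by rewrite (palindromic_coef CM_pal).
rewrite (transition_formula _ _ C_def QK); apply: specializes_sum => nu.
rewrite tofracM; apply: specializesM; first exact: specializes_const.
apply: specializes_prod => i; apply: specializesX.
exact: specializes_geometric.
Qed.
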